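(* (a) If $\Xi$ is a left-variant or right-variant scalar FQ operation which is orthogonally invariant and has constant term $\tilde p^{[0]}=1$, then $\Xi$ is the constant operation $1$. (c) If $\Xi$ is a left-variant pseudoscalar FQ operation which is orthogonally invariant and has constant term $\tilde p^{[12]}=1$, then $\Xi=\mathcal A_L$, the expansion around $(Q_1,Q_2)$ of $\mathcal A_L(A_1,A_2)=-\mathrm{pol}(A_1A_2^{-1})$. (c') If $\Xi$ is a right-variant pseudoscalar FQ operation which is orthogonally invariant and has constant term $\tilde p^{[12]}=1$, then $\Xi=\mathcal A_R$, the expansion around $(Q_1,Q_2)$ of $\mathcal A_R(A_1,A_2)=-\mathrm{pol}(A_1^{-1}A_2)$.
   Context: Setting. $(Q_1,Q_2)$ is a Clifford system: $Q_1^2=Q_2^2=-1$, $Q_1Q_2=-Q_2Q_1$. $R_1,R_2$ are formal noncommuting infinitesimal variables; one works in the real algebra generated by $Q_1,Q_2,R_1,R_2$ (free apart from the Clifford relations), completed with respect to total degree in $R_1,R_2$, or in extensions of it by further formal infinitesimal elements. Put $A_i=Q_i+R_i$. For $Q$ with $Q^2=-1$ and any $X$ put $X^0_Q=\frac12(X+Q^{-1}XQ)$, $X^1_Q=\frac12(X-Q^{-1}XQ)$. The split variables are $r_1,\dots,r_8$: for $j\in\{1,2\}$, $\iota_1,\iota_2\in\{0,1\}$, $r_{4(j-1)+2\iota_1+\iota_2+1}=((R_jQ_j^{-1})^{\iota_1}_{Q_1})^{\iota_2}_{Q_2}$. An FQ operation around $(Q_1,Q_2)$ is given by formal real noncommutative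 power series in eight variables: scalar $\Xi(A_1,A_2)=f_0(r_1,\dots,r_8)$, vectorial $\Xi(A_1,A_2)=(f_1(r)Q_1,f_2(r)Q_2)$, pseudoscalar $\Xi(A_1,A_2)=f_{12}(r)Q_1Q_2$; the operation is identified with this family of series. The same series can be evaluated relative to any other Clifford system $(Q_1',Q_2')$ at $(A_1',A_2')$ with $A'_i-Q'_i$ infinitesimal, by forming the split variables of $A_i'-Q_i'$ relative to $(Q'_1,Q'_2)$ and multiplying by $Q'_s$. The circular-basis constant term $\tilde p^{[s]}$ is simply the constant term of $f_s$. Orthogonal invariance: let $t$ be a central formal variable with $t^2=0$ and $\mathrm{Rot}_t(B_1,B_2)=(B_1+tB_2,\,B_2-tB_1)$. A (pseudo)scalar $\Xi$ is orthogonally invariant if $\Xi_{(Q_1,Q_2)}(A_1,A_2)=\Xi_{\mathrm{Rot}_t(Q_1,Q_2)}(\mathrm{Rot}_t(A_1,A_2))$, the subscript indicating the base Clifford system. Variance: with $\theta_1,\theta_2$ of the form $1+\epsilon$, $\epsilon$ a formal infinitesimal, and $\Xi$ evaluated around the fixed base $(Q_1,Q_2)$: $\Xi$ is left-variant if $\Xi(\theta_1A_1\theta_2,\theta_1A_2\theta_2)=\theta_1\Xi(A_1,A_2)\theta_1^{-1}$, right-variant if $\Xi(\theta_1A_1\theta_2,\theta_1A_2\theta_2)=\theta_2^{-1}\Xi(A_1,A_2)\theta_2$. For $X$ infinitesimally close to an element squaring to $-1$, $\mathrm{pol}\,X=X(-X^2)^{-1/2}$, the inverse square root given by the binomial power series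 around $1$. *)

(* Defs.v *)
From HB Require Import structures.
From mathcomp Require Import all_boot all_order all_algebra.
Set Implicit Arguments. Unset Strict Implicit. Unset Printing Implicit Defensive.
Import Order.TTheory GRing.Theory Num.Theory.
Local Open Scope ring_scope.

Section FQ.
Variable R : realFieldType.

(* A formal noncommutative power series in the eight variables r_1..r_8
   (indexed 0..7): its coefficient on each word. *)
Definition series := seq 'I_8 -> R.

Definition const_series (c : R) : series := fun w => if w is [::] then c else 0.

Definition nil_ideal (A : unitAlgType R) (I : pred A) (N : nat) : Prop :=
  [/\ 0 \in I,
      {in I &, forall x y, x - y \in I},
      (forall (c : R) x, x \in I -> c *: x \in I),
      (forall a x, x \in I -> a * x \in I /\ x * a \in I) &
      (forall s : N.-tuple A, all (fun x => x \in I) s -> \prod_(x <- s) x = 0)].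

(* Evaluation of a series at eight infinitesimals (truncated at degree N,
   which is exact when the arguments lie in an ideal I with I^N = 0). *)
Definition eval_series (A : unitAlgType R) (f : series) (N : nat) (x : 'I_8 -> A) : A :=
  \sum_(n < N) \sum_(w : n.-tuple 'I_8) f w *: \prod_(i <- w) x i.

Definition clifford (A : unitAlgType R) (Q1 Q2 : A) : Prop :=
  [/\ Q1 * Q1 = -1, Q2 * Q2 = -1 & Q1 * Q2 = - (Q2 * Q1)].

Definition qcomp (A : unitAlgType R) (b : bool) (Q X : A) : A :=
  if b then 2^-1 *: (X - Q^-1 * X * Q) else 2^-1 *: (X + Q^-1 * X * Q).

(* Split variables: index k = 4(j-1) + 2 iota1 + iota2 (0-based),
   r_k = ((R_j Q_j^-1)^{iota1}_{Q1})^{iota2}_{Q2}. *)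
Definition splitv (A : unitAlgType R) (Q1 Q2 R1 R2 : A) (k : 'I_8) : A :=
  let RQ := if (k < 4)%N then R1 * Q1^-1 else R2 * Q2^-1 in
  qcomp (odd k) Q2 (qcomp (odd k./2) Q1 RQ).

(* FQ operation given by the series f, scalar (ps = false: f(r)) or
   pseudoscalar (ps = true: f(r) Q1 Q2), evaluated relative to the base
   Clifford system (Q1,Q2) at (A1,A2). *)
Definition fq_eval (A : unitAlgType R) (ps : bool) (f : series) (N : nat)
    (Q1 Q2 A1 A2 : A) : A :=
  eval_series f N (splitv Q1 Q2 (A1 - Q1) (A2 - Q2)) * (if ps then Q1 * Q2 else 1).

Definition orth_invariant (ps : bool) (f : series) : Prop :=
  forall (A : unitAlgType R) (I : pred A) (N : nat), nil_ideal I N ->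
  forall Q1 Q2 : A, clifford Q1 Q2 ->
  forall R1 R2 : A, R1 \in I -> R2 \in I ->
  forall t : A, (forall a : A, t * a = a * t) -> t * t = 0 ->
  let A1 := Q1 + R1 in let A2 := Q2 + R2 in
  fq_eval ps f N Q1 Q2 A1 A2 =
  fq_eval ps f N (Q1 + t * Q2) (Q2 - t * Q1) (A1 + t * A2) (A2 - t * A1).

Definition left_variant (ps : bool) (f : series) : Prop :=
  forall (A : unitAlgType R) (I : pred A) (N : nat), nil_ideal I N ->
  forall Q1 Q2 : A, clifford Q1 Q2 ->
  forall R1 R2 e1 e2 : A, R1 \in I -> R2 \in I -> e1 \in I -> e2 \in I ->
  let A1 := Q1 + R1 in let A2 := Q2 + R2 in
  let th1 := 1 + e1 in let th2 := 1 + e2 in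
  fq_eval ps f N Q1 Q2 (th1 * A1 * th2) (th1 * A2 * th2) =
  th1 * fq_eval ps f N Q1 Q2 A1 A2 * th1^-1.

Definition right_variant (ps : bool) (f : series) : Prop :=
  forall (A : unitAlgType R) (I : pred A) (N : nat), nil_ideal I N ->
  forall Q1 Q2 : A, clifford Q1 Q2 ->
  forall R1 R2 e1 e2 : A, R1 \in I -> R2 \in I -> e1 \in I -> e2 \in I ->
  let A1 := Q1 + R1 in let A2 := Q2 + R2 in
  let th1 := 1 + e1 in let th2 := 1 + e2 in
  fq_eval ps f N Q1 Q2 (th1 * A1 * th2) (th1 * A2 * th2) =
  th2^-1 * fq_eval ps f N Q1 Q2 A1 A2 * th2.

Definition binom_mhalf (k : nat) : R :=
  \prod_(i < k) ((- 2^-1 - i%:R) / (i.+1)%:R).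

(* Y^{-1/2} = sum_k binom(-1/2,k) (Y-1)^k, truncated at N (exact when Y - 1
   lies in an ideal I with I^N = 0). *)
Definition invsqrt (A : unitAlgType R) (N : nat) (Y : A) : A :=
  \sum_(k < N) binom_mhalf k *: (Y - 1) ^+ k.

Definition pol (A : unitAlgType R) (N : nat) (X : A) : A :=
  X * invsqrt N (- (X * X)).

Definition is_AL (f : series) : Prop :=
  forall (A : unitAlgType R) (I : pred A) (N : nat), nil_ideal I N ->
  forall Q1 Q2 : A, clifford Q1 Q2 ->
  forall R1 R2 : A, R1 \in I -> R2 \in I ->
  let A1 := Q1 + R1 in let A2 := Q2 + R2 in
  fq_eval true f N Q1 Q2 A1 A2 = - pol N (A1 * A2^-1).

Definition is_AR (f : series) : Prop :=
  forall (A : unitAlgType R) (I : pred A) (N : nat), nil_ideal I N ->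
  forall Q1 Q2 : A, clifford Q1 Q2 ->
  forall R1 R2 : A, R1 \in I -> R2 \in I ->
  let A1 := Q1 + R1 in let A2 := Q2 + R2 in
  fq_eval true f N Q1 Q2 A1 A2 = - pol N (A1^-1 * A2).

End FQ.

(* Main.v *)
Require Import Defs.
From HB Require Import structures.
From mathcomp Require Import all_boot all_order all_algebra.
From mathcomp Require boolp.
From mathcomp Require Import ring lra zify.
Set Implicit Arguments. Unset Strict Implicit. Unset Printing Implicit Defensive.
Import Order.TTheory GRing.Theory Num.Theory.
Local Open Scope ring_scope.

(** Write P = - Q1 Q2, so that P^2 = -1, and let X be A1 A2^-1 (left case) or A1^-1 A2
    (right case). Then X is infinitesimally close to P, and so is S = pol X, which squares to
    -1; hence theta = (1 - P S) / 2 conjugates S into P. Variance then moves (A1, A2) to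
    ((1 + h) Q1, Q2) with h commuting with P, at the price of conjugating the value by theta.
    At such a point only the split variables r_1 and r_4 are non-zero, so everything reduces
    to showing that f vanishes on the non-empty words in these two letters.

    Let n be the least length of a non-empty word in r_1, r_4 on which f does not vanish.
    Conjugation of h by 1 + e, with e commuting with P, and the conjugation it induces on
    Q2 h Q2^-1 can be varied independently, so variance forces the part of degree n to be
    c (h_00 + s h_11)^n, with s = 1 in the left case and s = -1 in the right case. If h
    commutes with Q1 and Q2, the infinitesimal rotation replaces it by h + t h (2 + h) P, and
    invariance gives 2 n s c t P h^n = 0, so c = 0.

    Coefficients of f are read off as entries of upper triangular matrices. *)

(** * Nilpotent ideals and the binomial square root *)

Section NilIdeal.
Variables (R : realFieldType) (A : unitAlgType R) (I : pred A) (N : nat).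
Hypothesis nilI : nil_ideal I N.

Lemma nil0 : 0 \in I. Proof. by case: nilI. Qed.
Lemma nilB x y : x \in I -> y \in I -> x - y \in I.
Proof. by case: nilI => _ h _ _ _; apply: h. Qed.
Lemma nilN x : x \in I -> - x \in I.
Proof. by move=> xI; rewrite -sub0r nilB ?nil0. Qed.
Lemma nilD x y : x \in I -> y \in I -> x + y \in I.
Proof. by move=> xI yI; rewrite -[y]opprK nilB ?nilN. Qed.
Lemma nilZ c x : x \in I -> c *: x \in I.
Proof. by case: nilI => _ _ h _ _; apply: h. Qed.
Lemma nilMl a x : x \in I -> a * x \in I.
Proof. by case: nilI => _ _ _ h _ xI; case: (h a x xI). Qed.
Lemma nilMr a x : x \in I -> x * a \in I.
Proof. by case: nilI => _ _ _ h _ xI; case: (h a x xI). Qed.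

Lemma nilX x : x \in I -> x ^+ N = 0.
Proof.
move=> xI; case: nilI => _ _ _ _ /(_ [tuple of nseq N x]) <-.
  by rewrite big_nseq iter_mulr_1.
by apply/allP => y /nseqP[->].
Qed.

(** For [N = 0] the empty product, which is 1, would have to vanish. *)
Lemma nil_gt0 : (0 < N)%N.
Proof.
rewrite lt0n; apply/eqP => N0; have /eqP := nilX nil0.
by rewrite N0 expr0 oner_eq0.
Qed.

(** The geometric series in [- e] is finite, as [e ^+ N = 0], and inverts [1 + e]. *)
Lemma nil_unit e : e \in I -> 1 + e \is a GRing.unit.
Proof.
move=> eI; set s := \sum_(i < N) (- e) ^+ i.
have s1 : (1 + e) * s = 1.
  have := subrX1 (- e) N; rewrite nilX ?nilN // sub0r => /(congr1 -%R).
  by rewrite opprK -mulNr opprB opprK.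
apply/unitrP; exists s; split=> //; rewrite -[RHS]s1.
apply: esym; apply: commr_sum => i _; apply: commrX.
by rewrite /GRing.comm !(mulrDl, mulrDr, mulrN, mulNr, mul1r, mulr1).
Qed.

(** Being infinitesimally close, as congruence modulo the ideal. *)
Definition ceq x y := x - y \in I.

Lemma ceq_refl x : ceq x x. Proof. by rewrite /ceq subrr nil0. Qed.
Lemma ceq_sym x y : ceq x y -> ceq y x.
Proof. by rewrite /ceq => /nilN; rewrite opprB. Qed.
Lemma ceq_trans y x z : ceq x y -> ceq y z -> ceq x z.
Proof. by rewrite /ceq => /nilD h /h; rewrite addrA subrK. Qed.
Lemma ceqD x y x' y' : ceq x y -> ceq x' y' -> ceq (x + x') (y + y').
Proof. by rewrite /ceq => /nilD h /h; rewrite opprD addrACA. Qed.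
Lemma ceqN x y : ceq x y -> ceq (- x) (- y).
Proof. by rewrite /ceq -opprD => /nilN. Qed.
Lemma ceqZ c x y : ceq x y -> ceq (c *: x) (c *: y).
Proof. by rewrite /ceq -scalerBr => /nilZ. Qed.
Lemma ceqM x y x' y' : ceq x y -> ceq x' y' -> ceq (x * x') (y * y').
Proof.
move=> xy xy'; rewrite /ceq -[X in X - _](subrK (y * x')) -mulrBl -addrA -mulrBr.
by apply: nilD; [apply: nilMr | apply: nilMl].
Qed.
Lemma ceq_add x e : e \in I -> ceq (x + e) x.
Proof. by rewrite /ceq [x + e]addrC addrK. Qed.

Lemma ceq_unit x y : y \is a GRing.unit -> ceq x y -> x \is a GRing.unit.
Proof.
move=> yU xy; rewrite -[x](mulVKr yU) unitrMr //.
rewrite -[y^-1 * x](subrK 1) addrC; apply: nil_unit.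
by rewrite -(mulVr yU) -mulrBr nilMl.
Qed.

Lemma ceqV x y : y \is a GRing.unit -> ceq x y -> ceq x^-1 y^-1.
Proof.
move=> yU xy; have xU := ceq_unit yU xy; apply: ceq_sym.
suff -> : ceq y^-1 x^-1 = (y^-1 * (x - y) * x^-1 \in I) by rewrite nilMr ?nilMl.
by rewrite /ceq mulrBr mulrBl mulVr // mul1r mulrK.
Qed.

End NilIdeal.

Section InvSqrt.
Variable R : realFieldType.
Local Notation b := (binom_mhalf R).

Lemma binom_mhalfS k : b k.+1 * k.+1%:R = b k * (- 2^-1 - k%:R).
Proof.
rewrite /binom_mhalf big_ord_recr /= -!mulrA mulVf ?mulr1 //.
by rewrite pnatr_eq0.
Qed.

(** The coefficients of the square of the series of [(1 + z)^(-1/2)], to be compared with those of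
    [1 / (1 + z)]. *)
Definition binom_conv k := \sum_(i < k.+1) b i * b (k - i)%N.

(* Both weights i and k - i contribute the same amount by symmetry. *)
Lemma binom_convW k : 2 * \sum_(i < k.+1) i%:R * (b i * b (k - i)%N) = k%:R * binom_conv k.
Proof.
rewrite mulrDl !mul1r [X in X + _](reindex_inj rev_ord_inj) /= -big_split /=.
rewrite /binom_conv mulr_sumr; apply: eq_bigr => i _.
have ik : (i <= k)%N by rewrite -ltnS.
rewrite subSS subKn // [b (k - i)%N * _]mulrC -mulrDl -natrD subnK //.
Qed.

(** The differential equation [(1 + z) g' = - g] on coefficients: the recurrence for [binom_mhalf]
    shifts the weighted sum from degree [k + 1] to [k], and [binom_convW] removes the weights. *)
Lemma binom_convS k : binom_conv k.+1 = - binom_conv k.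
Proof.
apply: (@mulfI _ k.+1%:R); first by rewrite pnatr_eq0.
rewrite -binom_convW big_ord_recl mul0r add0r /=.
under eq_bigr => i _.
  rewrite /bump /= add1n subSS mulrA [_%:R * _]mulrC binom_mhalfS.
  rewrite (_ : _ * _ * _ = - 2^-1 * (b i * b (k - i)%N) - i%:R * (b i * b (k - i)%N)); last by ring.
over.
rewrite sumrB -mulr_sumr -/(binom_conv k) mulrBr binom_convW.
rewrite mulrA mulrN divff ?pnatr_eq0 // -natr1; ring.
Qed.

Lemma binom_convE k : binom_conv k = (-1) ^+ k.
Proof.
elim: k => [|k IHk]; last by rewrite binom_convS IHk exprS mulN1r.
by rewrite /binom_conv big_ord1 /binom_mhalf !big_ord0 mulr1.
Qed.

Variables (A : unitAlgType R) (I : pred A) (N : nat).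
Hypothesis nilI : nil_ideal I N.

(** As a polynomial in [Y - 1], the truncated series can be squared inside the commutative ring
    [{poly R}]. *)
Lemma invsqrtE (Y : A) :
  invsqrt N Y = horner_alg (Y - 1) (\poly_(k < N) b k).
Proof.
rewrite /invsqrt poly_def rmorph_sum; apply: eq_bigr => k _ /=.
by rewrite linearZ /= rmorphXn /= horner_algX mulr_algl.
Qed.

Lemma invsqrt_comm (X Y : A) : GRing.comm X Y -> GRing.comm X (invsqrt N Y).
Proof.
move=> cXY; rewrite /invsqrt; apply: commr_sum => k _; rewrite /GRing.comm -scalerAr -scalerAl.
by congr (_ *: _); apply: commrX; apply: commrB => //; apply: commr1.
Qed.

Lemma invsqrt_ceq (Y : A) : ceq I Y 1 -> ceq I (invsqrt N Y) 1.
Proof.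
move=> Y1; rewrite /invsqrt -(prednK (nil_gt0 nilI)).
rewrite big_ord_recl /binom_mhalf big_ord0 expr0 scale1r addrC.
rewrite /ceq addrK; elim/big_ind: _ => //; first exact: nil0 nilI.
  by move=> x y; apply: nilD nilI _ _.
by move=> i _; apply: (nilZ nilI); rewrite exprS; apply: (nilMr nilI).
Qed.

Lemma invsqrt_sqr (Y : A) : ceq I Y 1 -> invsqrt N Y * invsqrt N Y * Y = 1.
Proof.
move=> Y1; rewrite invsqrtE; set p := \poly_(k < N) b k.
have -> : horner_alg (Y - 1) p * horner_alg (Y - 1) p * Y =
          horner_alg (Y - 1) (p * p * (1 + 'X)).
  by rewrite !rmorphM rmorphD /= rmorph1 horner_algX subrKC.
have cp k : (k < N)%N -> (p * p)`_k = (-1) ^+ k.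
  move=> kN; rewrite coefM -binom_convE; apply: eq_bigr => i _.
  rewrite !coef_poly (leq_ltn_trans _ kN) 1?(leq_ltn_trans _ kN) ?leq_subr //.
  by rewrite -ltnS.
(* Below degree [N] the coefficients of [p * p] are alternating signs, so the factor [1 + 'X] leaves
   1 plus terms of degree at least [N], which vanish at [Y - 1]. *)
have -> : p * p * (1 + 'X) = 1 + drop_poly N (p * p * (1 + 'X)) * 'X^N.
  rewrite -{1}[p * p * _](poly_take_drop N); congr (_ + _).
  apply/polyP => k; rewrite coef_take_poly coef1.
  case: ltnP => [kN|Nk].
    rewrite mulrDr mulr1 coefD coefMX cp //; case: k kN => [|k] kN /=.
      by rewrite addr0.
    by rewrite cp ?(ltnW kN) // exprS mulN1r addNr.
  by case: k Nk => //; rewrite leqNgt (nil_gt0 nilI).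
rewrite rmorphD rmorph1 rmorphM /= rmorphXn /= horner_algX.
by rewrite (nilX nilI) // mulr0 addr0.
Qed.

End InvSqrt.

(** * Split variables and the reduction to a normal form *)

(** The zero-based indices of r_1 and r_4: the components of [R1 * Q1^-1] commuting with both [Q1]
    and [Q2], respectively anticommuting with both. *)
Definition k0 : 'I_8 := ord0.
Definition k3 : 'I_8 := Ordinal (isT : (3 < 8)%N).

Section Algebra.
Variables (R : realFieldType) (A : unitAlgType R).
Implicit Types (x y u Q P X Z : A) (b e : bool).

Lemma sqrN1_unit Q : Q * Q = -1 -> Q \is a GRing.unit.
Proof.
by move=> QQ; apply/unitrP; exists (- Q); rewrite mulrN mulNr QQ opprK.
Qed.

Lemma sqrN1_inv Q : Q * Q = -1 -> Q^-1 = - Q.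
Proof.
move=> QQ; apply: (mulrI (sqrN1_unit QQ)).
by rewrite mulrN QQ opprK divrr ?sqrN1_unit.
Qed.

Lemma scale_half x : 2^-1 *: (x + x) = x.
Proof. by rewrite -mulr2n -scaler_nat scalerA mulVf ?scale1r // pnatr_eq0. Qed.

Definition qpar e Q X := X * Q = if e then - (Q * X) else Q * X.

Lemma qcomp_sum b Q (J : Type) (s : seq J) (p : pred J) F :
  qcomp b Q (\sum_(j <- s | p j) F j) = \sum_(j <- s | p j) qcomp b Q (F j).
Proof.
apply: (big_morph (qcomp b Q)) => [x y|].
  by rewrite /qcomp; case: b; rewrite -scalerDr !mulrDr !mulrDl;
     congr (_ *: _); rewrite ?opprD addrACA.
by rewrite /qcomp; case: b; rewrite mulr0 mul0r ?subr0 ?addr0 scaler0.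
Qed.

Lemma qcomp_par b e Q X : Q \is a GRing.unit -> qpar e Q X ->
  qcomp b Q X = if b == e then X else 0.
Proof.
move=> QU; rewrite /qpar => XQ.
case: e XQ => XQ; case: b; rewrite /qcomp -mulrA XQ ?mulrN mulKr //.
- by rewrite opprK scale_half.
- by rewrite subrr scaler0.
- by rewrite subrr scaler0.
by rewrite scale_half.
Qed.

Lemma qpar0 e Q : qpar e Q 0.
Proof. by rewrite /qpar mul0r mulr0; case: e; rewrite ?oppr0. Qed.

(** Within each group of four indices the two parities determine the index, so any eight elements of
    the right parities occur as split variables. *)
Lemma splitv_sum Q1 Q2 (r : 'I_8 -> A) : clifford Q1 Q2 ->
    (forall k : 'I_8, qpar (odd k./2) Q1 (r k)) ->
    (forall k : 'I_8, qpar (odd k) Q2 (r k)) ->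
  splitv Q1 Q2 ((\sum_(k < 8 | (k < 4)%N) r k) * Q1)
               ((\sum_(k < 8 | ~~ (k < 4)%N) r k) * Q2) =1 r.
Proof.
move=> [Q11 Q22 _] r1 r2 k; rewrite /splitv !mulrK ?sqrN1_unit //.
have comp (p : pred 'I_8) :
    qcomp (odd k) Q2 (qcomp (odd k./2) Q1 (\sum_(i < 8 | p i) r i)) =
    \sum_(i < 8 | p i) if (odd k == odd i) && (odd k./2 == odd i./2) then r i else 0.
  rewrite !qcomp_sum; apply: eq_bigr => i _; rewrite (qcomp_par _ _ (r1 i)) ?sqrN1_unit //.
  case: ifP => _; last by rewrite
    (qcomp_par _ (e := false)) ?sqrN1_unit ?if_same ?andbF //; apply: qpar0.
  by rewrite (qcomp_par _ _ (r2 i)) ?sqrN1_unit // andbT.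
have [k4|k4] := boolP (k < 4)%N; rewrite comp (bigD1 k) //= !eqxx /= big1 ?addr0 {comp} // => i.
  by case: i k k4 => [[|[|[|[|i]]]] hi] [[|[|[|[|k]]]] hk].
by case: i k k4 => [[|[|[|[|[|[|[|[|i]]]]]]]] hi] [[|[|[|[|[|[|[|[|k]]]]]]]] hk].
Qed.

Definition split_pair X Z (k : 'I_8) := if k == k0 then X else if k == k3 then Z else 0.

Lemma splitv_pair Q1 Q2 X Z : clifford Q1 Q2 ->
    qpar false Q1 X -> qpar false Q2 X -> qpar true Q1 Z -> qpar true Q2 Z ->
  splitv Q1 Q2 ((X + Z) * Q1) 0 =1 split_pair X Z.
Proof.
move=> Q12 X1 X2 Z1 Z2 k; rewrite -(@splitv_sum Q1 Q2 (split_pair X Z)) //.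
- congr (splitv _ _ _ _ _).
    by rewrite !big_mkcond /= !big_ord_recl big_ord0 /= !add0r !addr0.
  by rewrite !big_mkcond /= !big_ord_recl big_ord0 /= !add0r mul0r.
- by case=> [[|[|[|[|i]]]] hi] //; apply: qpar0.
by case=> [[|[|[|[|i]]]] hi] //; apply: qpar0.
Qed.

Definition conjby u x := u * x * u^-1.

Section Conj.
Variable u : A.
Hypothesis uU : u \is a GRing.unit.
Lemma conjD x y : conjby u (x + y) = conjby u x + conjby u y.
Proof. by rewrite /conjby mulrDr mulrDl. Qed.
Lemma conjN x : conjby u (- x) = - conjby u x.
Proof. by rewrite /conjby mulrN mulNr. Qed.
Lemma conjZ c x : conjby u (c *: x) = c *: conjby u x.
Proof. by rewrite /conjby -scalerAr -scalerAl. Qed.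
Lemma conjM x y : conjby u (x * y) = conjby u x * conjby u y.
Proof. by rewrite /conjby !mulrA mulrVK. Qed.
Lemma conj1 : conjby u 1 = 1.
Proof. by rewrite /conjby mulr1 mulrV. Qed.
Lemma conj_unit x : (conjby u x \is a GRing.unit) = (x \is a GRing.unit).
Proof. by rewrite /conjby unitrMl ?unitrV // unitrMr. Qed.
Lemma conjV x : x \is a GRing.unit -> conjby u x^-1 = (conjby u x)^-1.
Proof.
move=> xU; apply: (@mulrI _ (conjby u x)); first by rewrite conj_unit.
by rewrite -conjM (mulrV xU) conj1 mulrV ?conj_unit.
Qed.
Lemma conj_inj : injective (conjby u).
Proof. by move=> x y; rewrite /conjby => /(mulIr _) /(mulrI uU) -> //; rewrite unitrV. Qed.
Lemma conj_comm x : GRing.comm u x -> conjby u x = x.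
Proof. by rewrite /conjby => ->; rewrite mulrK. Qed.

Lemma qcomp_conj b Q X : Q \is a GRing.unit ->
  qcomp b (conjby u Q) (conjby u X) = conjby u (qcomp b Q X).
Proof.
by move=> QU; rewrite /qcomp -conjV // -!conjM; case: b; rewrite conjZ conjD ?conjN.
Qed.

Lemma splitv_conj Q1 Q2 X Y k : Q1 \is a GRing.unit -> Q2 \is a GRing.unit ->
  splitv (conjby u Q1) (conjby u Q2) (conjby u X) (conjby u Y) k = conjby u (splitv Q1 Q2 X Y k).
Proof.
move=> Q1U Q2U; rewrite /splitv -!conjV // -!conjM.
by case: ifP => _; rewrite !qcomp_conj.
Qed.
End Conj.

Lemma eq_eval_series (f : series R) N (x y : 'I_8 -> A) : x =1 y ->
  eval_series f N x = eval_series f N y.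
Proof.
move=> xy; apply: eq_bigr => n _; apply: eq_bigr => w _; congr (_ *: _).
exact: eq_bigr.
Qed.

Lemma eval_series_conj (f : series R) N u (x : 'I_8 -> A) : u \is a GRing.unit ->
  eval_series f N (fun k => conjby u (x k)) = conjby u (eval_series f N x).
Proof.
move=> uU; rewrite /eval_series (big_morph (conjby u) (conjD u) (_ : conjby u 0 = 0)); last first.
  by rewrite /conjby mulr0 mul0r.
apply: eq_bigr => n _; rewrite (big_morph (conjby u) (conjD u) (_ : conjby u 0 = 0)); last first.
  by rewrite /conjby mulr0 mul0r.
apply: eq_bigr => w _; rewrite conjZ; congr (_ *: _).
by rewrite (big_morph (conjby u) (conjM uU) (conj1 uU)).
Qed.

(** Split variables and series are ring expressions in the base and the arguments, hence compatible
    with a common conjugation. *)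
Lemma fq_eval_conj ps (f : series R) N u Q1 Q2 A1 A2 : u \is a GRing.unit ->
    Q1 \is a GRing.unit -> Q2 \is a GRing.unit ->
  fq_eval ps f N (conjby u Q1) (conjby u Q2) (conjby u A1) (conjby u A2) =
  conjby u (fq_eval ps f N Q1 Q2 A1 A2).
Proof.
move=> uU Q1U Q2U; rewrite /fq_eval conjM // -eval_series_conj //; congr (_ * _).
  by apply: eq_eval_series => k; rewrite -!conjN -!conjD splitv_conj.
by case: ps; rewrite ?conjM ?conj1.
Qed.

Definition hom_series (f : series R) n (x : 'I_8 -> A) : A :=
  \sum_(w : n.-tuple 'I_8) f w *: \prod_(i <- w) x i.

Lemma hom_series0 f (x : 'I_8 -> A) : hom_series f 0 x = (f [::])%:A.
Proof.
rewrite /hom_series (bigD1 [tuple]) //= big_nil big1 ?addr0 // => w.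
by move/eqP; rewrite [w]tuple0.
Qed.

Lemma prod_eq0 (x : 'I_8 -> A) w k : k \in w -> x k = 0 -> \prod_(i <- w) x i = 0.
Proof.
move=> kw xk; elim: w kw => // i w IHw; rewrite inE big_cons => /orP[/eqP <-|/IHw ->].
  by rewrite xk mul0r.
by rewrite mulr0.
Qed.

Lemma hom_series_eq0 f n (x : 'I_8 -> A) :
    (forall k, k \notin pred2 k0 k3 -> x k = 0) ->
    (forall w : seq 'I_8, size w = n -> all [in pred2 k0 k3] w -> f w = 0) ->
  hom_series f n x = 0.
Proof.
move=> x0 f0; apply: big1 => w _; have [w03|] := boolP (all [in pred2 k0 k3] w).
  by rewrite f0 ?size_tuple // scale0r.
by case/allPn => k kw /x0 xk; rewrite (prod_eq0 kw xk) scaler0.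
Qed.

End Algebra.

(** Both variances in one form, right for [sd = true]; infinitesimals are replaced by congruences,
    and right variance becomes conjugation by [th2^-1]. *)
Definition variant (R : realFieldType) (sd ps : bool) (f : series R) : Prop :=
  forall (A : unitAlgType R) (I : pred A) (N : nat), nil_ideal I N ->
  forall Q1 Q2 : A, clifford Q1 Q2 ->
  forall A1 A2 th1 th2 : A, ceq I A1 Q1 -> ceq I A2 Q2 -> ceq I th1 1 -> ceq I th2 1 ->
  fq_eval ps f N Q1 Q2 (th1 * A1 * th2) (th1 * A2 * th2) =
  conjby (if sd then th2^-1 else th1) (fq_eval ps f N Q1 Q2 A1 A2).

Lemma left_variantE (R : realFieldType) ps (f : series R) :
  left_variant ps f -> variant false ps f.
Proof.
move=> H A I N nilI Q1 Q2 Q12 A1 A2 th1 th2 a1 a2 t1 t2.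
by have := H A I N nilI Q1 Q2 Q12 _ _ _ _ a1 a2 t1 t2; rewrite !subrKC.
Qed.

Lemma right_variantE (R : realFieldType) ps (f : series R) :
  right_variant ps f -> variant true ps f.
Proof.
move=> H A I N nilI Q1 Q2 Q12 A1 A2 th1 th2 a1 a2 t1 t2; rewrite /conjby invrK.
by have := H A I N nilI Q1 Q2 Q12 _ _ _ _ a1 a2 t1 t2; rewrite !subrKC.
Qed.

(* The words that survive at [((1 + h) Q1, Q2)] with [h] commuting with [Q1 Q2]. *)
Definition vanish03 (R : realFieldType) (f : series R) : Prop :=
  forall w : seq 'I_8, w != [::] -> all [in pred2 k0 k3] w -> f w = 0.

(* Locked so that rewriting rules for opposites do not see through it. *)
Definition cliffP (R : realFieldType) (A : unitAlgType R) (Q1 Q2 : A) := locked (- (Q1 * Q2)).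
Lemma cliffPE (R : realFieldType) (A : unitAlgType R) (Q1 Q2 : A) :
  cliffP Q1 Q2 = - (Q1 * Q2).
Proof. by rewrite /cliffP -lock. Qed.

Section NormalForm.
Variables (R : realFieldType) (f : series R).
Hypotheses (f03 : vanish03 f) (f1 : f [::] = 1).
Variables (A : unitAlgType R) (I : pred A) (N : nat).
Hypothesis nilI : nil_ideal I N.
Variables Q1 Q2 : A.
Hypothesis Q12 : clifford Q1 Q2.
Implicit Types ps : bool.

Let Q11 : Q1 * Q1 = -1. Proof. by case: Q12. Qed.
Let Q22 : Q2 * Q2 = -1. Proof. by case: Q12. Qed.
Let QA : Q1 * Q2 = - (Q2 * Q1). Proof. by case: Q12. Qed.
Local Notation P := (cliffP Q1 Q2).

Lemma clifford_Psqr : P * P = -1.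
Proof. by rewrite cliffPE mulrNN {1}QA mulNr mulrA -(mulrA Q2) Q11 mulrN1 mulNr opprK Q22. Qed.
Lemma clifford_PQ2 : P * Q2 = Q1.
Proof. by rewrite cliffPE mulNr -mulrA Q22 mulrN1 opprK. Qed.
Lemma clifford_Q2P : Q2 * P = - Q1.
Proof. by rewrite cliffPE mulrN QA mulrN opprK mulrA Q22 mulN1r. Qed.
Lemma clifford_Q1P : Q1 * P = Q2.
Proof. by rewrite cliffPE mulrN mulrA Q11 mulN1r opprK. Qed.
Lemma clifford_PQ1 : P * Q1 = - Q2.
Proof. by rewrite cliffPE QA opprK -mulrA Q11 mulrN1. Qed.

(** As [h] commutes with [P], conjugation by [Q1] and by [Q2] agree on it, so [h] is the sum of a
    part commuting with both and a part anticommuting with both. *)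
Lemma splitv_comm h : GRing.comm P h -> forall k, k \notin pred2 k0 k3 ->
  splitv Q1 Q2 (h * Q1) 0 k = 0.
Proof.
(* As [Q2^-1 = - Q2], [hb] is minus a conjugate of [h]; the two parts are [(h - hb) / 2] and
   [(h + hb) / 2]. *)
move=> Ph k; set hb := Q2 * h * Q2.
have hb2 : hb * Q2 = - (Q2 * h) by rewrite /hb -mulrA Q22 mulrN1.
have h2b : Q2 * hb = - (h * Q2) by rewrite /hb !mulrA Q22 mulN1r mulNr.
have hb1 : hb * Q1 = - (Q1 * h).
  by rewrite /hb -mulrA -(opprK (Q2 * Q1)) -QA -(cliffPE Q1 Q2) -mulrA -Ph mulrA clifford_Q2P mulNr.
have h1b : Q1 * hb = - (h * Q1).
  have QP : Q1 * Q2 = - P by rewrite cliffPE opprK.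
  by rewrite /hb !mulrA QP 2!mulNr Ph -mulrA clifford_PQ2.
have -> : h = 2^-1 *: (h - hb) + 2^-1 *: (h + hb).
  by rewrite -scalerDr addrACA addNr addr0 scale_half.
rewrite splitv_pair // /qpar /split_pair -?scalerAl -?scalerAr -?scalerN.
- by rewrite !inE negb_or => /andP[/negPf-> /negPf->].
- by congr (_ *: _); rewrite mulrBl mulrBr hb1 h1b !opprK addrC.
- by congr (_ *: _); rewrite mulrBl mulrBr hb2 h2b !opprK addrC.
- by congr (_ *: _); rewrite mulrDl mulrDr hb1 h1b opprD opprK addrC.
- by congr (_ *: _); rewrite mulrDl mulrDr hb2 h2b opprD opprK addrC.
Qed.

Lemma fq_eval_normal ps h : GRing.comm P h ->
  fq_eval ps f N Q1 Q2 ((1 + h) * Q1) Q2 = if ps then Q1 * Q2 else 1.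
Proof.
move=> Ph; rewrite /fq_eval mulrDl mul1r addrC addKr subrr.
rewrite (_ : eval_series _ _ _ = 1) ?mul1r // /eval_series -(prednK (nil_gt0 nilI)).
rewrite big_ord_recl -/(hom_series _ _ _) hom_series0 f1 scale1r big1 ?addr0 // => n _.
apply: hom_series_eq0 => [k k03|w sw w03]; first exact: splitv_comm.
by apply: f03 => //; rewrite -size_eq0 sw.
Qed.

(** The inverse square root is a polynomial in [X], so all factors commute and the square is
    [X^2 (- X^2)^(-1)]. *)
Lemma pol_ceq X : ceq I X P ->
  [/\ ceq I (pol N X) P, pol N X * pol N X = -1 & GRing.comm (pol N X) X].
Proof.
move=> XP; have Y1 : ceq I (- (X * X)) 1.
  by rewrite -[1]opprK -clifford_Psqr; apply: (ceqN nilI); apply: (ceqM nilI).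
have cX : GRing.comm X (invsqrt N (- (X * X))).
  by apply: invsqrt_comm; apply: commrN; apply: commrM.
split.
- by rewrite /pol -[P]mulr1; apply: (ceqM nilI) => //; apply: (invsqrt_ceq nilI).
- rewrite /pol mulrA -(mulrA X) -cX mulrA -mulrA.
  have := invsqrt_sqr nilI Y1; set w := invsqrt _ _; rewrite mulrN => /(congr1 -%R).
  rewrite opprK => <-; have cXX : GRing.comm (X * X) (w * w).
    by apply: commrM; apply/commr_sym; apply: commrM; apply/commr_sym.
  by rewrite -cXX !mulrA.
apply: commr_sym; rewrite /pol; apply: commrM => //.
Qed.

(** With [S = pol N X], both [P * th] and [th * S] equal [(P + S) / 2], because [P] and [S] square
    to -1. *)
Lemma pol_conj X : ceq I X P ->
  exists2 th, ceq I th 1 & conjby th (pol N X) = P.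
Proof.
move=> /pol_ceq[SP SS _]; set S := pol N X in SP SS *.
set th := 2^-1 *: (1 - P * S).
have th1 : ceq I th 1.
  have -> : 1 = 2^-1 *: (1 - P * P) by rewrite clifford_Psqr opprK scale_half.
  by apply: (ceqZ nilI); apply: (ceqD nilI (ceq_refl nilI _)); apply: (ceqN nilI);
     apply: (ceqM nilI (ceq_refl nilI _)).
exists th => //.
have thU := ceq_unit nilI (unitr1 _) th1.
apply: (mulIr thU); rewrite /conjby mulrVK // /th -scalerAl -scalerAr; congr (_ *: _).
by rewrite mulrBl mulrBr mul1r mulr1 -mulrA SS mulrN1 opprK mulrA clifford_Psqr mulN1r opprK addrC.
Qed.

(** After conjugation by [th] the right-hand side is the constant [Q1 * Q2] or 1, and by variance
    the left-hand side is the value at a normal form. *)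
Lemma fq_eval_variant sd ps A1 A2 : variant sd ps f -> ceq I A1 Q1 -> ceq I A2 Q2 ->
  fq_eval ps f N Q1 Q2 A1 A2 =
  if ps then - pol N (if sd then A1^-1 * A2 else A1 * A2^-1) else 1.
Proof.
move=> var a1 a2; set X := if sd then _ else _.
have Q1U := sqrN1_unit Q11; have Q2U := sqrN1_unit Q22.
have A1U := ceq_unit nilI Q1U a1; have A2U := ceq_unit nilI Q2U a2.
have PU := sqrN1_unit clifford_Psqr.
have XP : ceq I X P.
  rewrite /X; case: sd {X var}.
    rewrite cliffPE -mulNr -(sqrN1_inv Q11).
    by apply: (ceqM nilI) => //; apply: (ceqV nilI).
  rewrite cliffPE -mulrN -(sqrN1_inv Q22).
  by apply: (ceqM nilI) => //; apply: (ceqV nilI).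
have XU := ceq_unit nilI PU XP.
have [SP SS SX] := pol_ceq XP; have [th th1 thS] := pol_conj XP.
set S := pol N X in SP SS SX thS *.
have thU := ceq_unit nilI (unitr1 _) th1.
apply: (conj_inj thU).
have -> : conjby th (if ps then - S else 1) = if ps then Q1 * Q2 else 1.
  by case: ps {var}; rewrite ?conj1 // conjN thS cliffPE opprK.
have thV1 : ceq I th^-1 1 by rewrite -[1]invr1; apply: (ceqV nilI (unitr1 _)).
have : X = if sd then A1^-1 * A2 else A1 * A2^-1 by [].
clearbody S; clearbody X; case: sd var => var XE.
  (* Right case: the second factor must be [th^-1], and the first is chosen so that [A2] goes to
     [Q2]. *)
  have t1 : ceq I (Q2 * th * A2^-1) 1.
    rewrite -(mulrV Q2U) -[X in ceq _ _ (X * _)]mulr1.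
    by apply: (ceqM nilI); [apply: (ceqM nilI (ceq_refl nilI _)) | apply: (ceqV nilI)].
  have := var A I N nilI Q1 Q2 Q12 A1 A2 _ _ a1 a2 t1 thV1; rewrite invrK => <-.
  set W := S * X^-1; set W' := conjby th W.
  have SW : GRing.comm S W by apply: commrM => //; apply: commrV.
  have PW : GRing.comm P W' by rewrite /GRing.comm -thS -!conjM // SW.
  rewrite -(@fq_eval_normal ps (conjby Q1 W' - 1)).
    rewrite subrKC; congr (fq_eval _ _ _ _ _ _ _); last by rewrite mulrVK // mulrK.
    have -> : Q2 * th * A2^-1 * A1 * th^-1 = Q2 * conjby th (A2^-1 * A1).
      by rewrite /conjby !mulrA.
    have -> : A2^-1 * A1 = - (S * W).
      by rewrite /W mulrA SS mulN1r opprK XE invrM ?unitrV // invrK.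
    rewrite conjN conjM // thS -/W' mulrN mulrA clifford_Q2P mulNr opprK.
    by rewrite /conjby mulrVK.
  apply: commrB; last exact: commr1.
  (* Conjugation by [Q1] negates [P], hence preserves its commutant. *)
  have <- : - conjby Q1 P = P.
    by rewrite /conjby clifford_Q1P (sqrN1_inv Q11) mulrN opprK -[Q2 * Q1]opprK -QA cliffPE.
  by apply: commr_sym; apply: commrN; rewrite /GRing.comm -!conjM // PW.
(* Left case: the first factor is [th], and the second is chosen so that [A2] goes to [Q2]. *)
have t2 : ceq I (A2^-1 * th^-1 * Q2) 1.
  rewrite -(mulVr Q2U) -[X in ceq _ _ (X * _)]mulr1.
  apply: (ceqM nilI (ceqM nilI _ thV1) (ceq_refl nilI _)).
  exact: (ceqV nilI).
have := var A I N nilI Q1 Q2 Q12 A1 A2 _ _ a1 a2 th1 t2 => <-.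
(* A polar decomposition [X = W * S] with commuting factors: conjugation turns [S] into [P], and
   [P * Q2 = Q1] leaves [W' * Q1]. *)
set W := - (S * X); set W' := conjby th W.
have SW : GRing.comm S W by apply: commrN; apply: commrM.
have PW : GRing.comm P W' by rewrite /GRing.comm -thS -!conjM // SW.
rewrite -(@fq_eval_normal ps (W' - 1)); last by apply: commrB => //; apply: commr1.
rewrite subrKC; congr (fq_eval _ _ _ _ _ _ _); last first.
  by rewrite !mulrA mulrK // mulrV // mul1r.
have -> : th * A1 * (A2^-1 * th^-1 * Q2) = conjby th X * Q2 by rewrite XE /conjby !mulrA.
have -> : X = W * S by rewrite -SW /W mulrN mulrA SS mulN1r opprK.
by rewrite conjM // thS -mulrA clifford_PQ2.
Qed.

End NormalForm.

(** * Block triangular matrix algebras *)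

Section BlockTriangular.
Variables (R : realFieldType) (B : algType R) (m : nat).
Variables (lv : nat -> nat) (T : 'M[B]_m.+1).

(* Matrices that are block triangular for the levels [lv]: those strictly raising the level
   form a nilpotent ideal, which the full matrix algebra does not have. Commutation with [T]
   makes [T] central. *)
Definition bt_pred : pred 'M[B]_m.+1 :=
  [pred M : 'M[B]_m.+1 | [forall i : 'I_m.+1, forall l : 'I_m.+1, (lv l < lv i)%N ==> (M i l == 0)]
            && (T *m M == M *m T)].

Lemma bt_predP (M : 'M[B]_m.+1) :
  reflect ((forall i l : 'I_m.+1, (lv l < lv i)%N -> M i l = 0) /\ T *m M = M *m T)
          (M \in bt_pred).
Proof.
apply: (iffP andP) => [[/forallP h /eqP ->]|[h ->]]; split=> //.
  by move=> i l il; have /forallP/(_ l)/implyP/(_ il)/eqP := h i.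
by apply/forallP=> i; apply/forallP=> l; apply/implyP=> il; rewrite h.
Qed.

Lemma bt_subring : subring_closed bt_pred.
Proof.
split.
- apply/bt_predP; rewrite mulmx1 mul1mx; split=> // i l il.
  by rewrite mxE; case: eqP il => // ->; rewrite ltnn.
- move=> M N /bt_predP[M0 MT] /bt_predP[N0 NT]; apply/bt_predP; split.
    by move=> i l il; rewrite !mxE M0 // N0 // subrr.
  by rewrite mulmxBl mulmxBr MT NT.
move=> M N /bt_predP[M0 MT] /bt_predP[N0 NT]; apply/bt_predP; split.
  move=> i l il; rewrite mxE big1 // => k _.
  have [ki|ik] := ltnP (lv k) (lv i); first by rewrite M0 // mul0r.
  by rewrite N0 ?mulr0 // (leq_trans il).
by rewrite mulmxA MT -mulmxA NT mulmxA.
Qed.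

HB.instance Definition _ := GRing.isSubringClosed.Build _ bt_pred bt_subring.

Record bt := Bt { bt_val :> 'M[B]_m.+1; bt_valP : bt_val \in bt_pred }.

HB.instance Definition _ := [isSub for bt_val].
HB.instance Definition _ := [Choice of bt by <:].
HB.instance Definition _ := [SubChoice_isSubNzRing of bt by <:].

(** Matrices over [B] are naturally a module over [B]; the action of [R] is imposed entrywise. *)
Lemma bt_scale_subproof (c : R) (M : bt) : map_mx (fun b => c *: b) M \in bt_pred.
Proof.
case: M => M /= /bt_predP[M0 MT]; apply/bt_predP; split.
  by move=> i l il; rewrite mxE M0 // scaler0.
apply/matrixP=> i l; move/matrixP/(_ i l): MT; rewrite !mxE => /(congr1 ( *:%R c)).
rewrite !scaler_sumr => e; under eq_bigr => k _ do rewrite mxE -scalerAr.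
by rewrite e; apply: eq_bigr => k _; rewrite mxE -scalerAl.
Qed.

Definition bt_scale c M := Bt (bt_scale_subproof c M).

Fact bt_scalerA a b v : bt_scale a (bt_scale b v) = bt_scale (a * b) v.
Proof. by apply/val_inj/matrixP=> i l; rewrite !mxE scalerA. Qed.
Fact bt_scale1r : left_id 1 bt_scale.
Proof. by move=> v; apply/val_inj/matrixP=> i l; rewrite !mxE scale1r. Qed.
Fact bt_scalerDr : right_distributive bt_scale +%R.
Proof. by move=> c u v; apply/val_inj/matrixP=> i l; rewrite !mxE scalerDr. Qed.
Fact bt_scalerDl v : {morph bt_scale^~ v: a b / a + b}.
Proof. by move=> a b; apply/val_inj/matrixP=> i l; rewrite !mxE scalerDl. Qed.
HB.instance Definition _ := GRing.Zmodule_isLmodule.Build R bt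
  bt_scalerA bt_scale1r bt_scalerDr bt_scalerDl.

Fact bt_scalerAl (a : R) (u v : bt) : a *: (u * v) = (a *: u) * v.
Proof.
apply/val_inj/matrixP=> i l; rewrite !mxE scaler_sumr.
by apply: eq_bigr => k _; rewrite mxE scalerAl.
Qed.
HB.instance Definition _ := GRing.Lmodule_isLalgebra.Build R bt bt_scalerAl.

Fact bt_scalerAr (a : R) (u v : bt) : a *: (u * v) = u * (a *: v).
Proof.
apply/val_inj/matrixP=> i l; rewrite !mxE scaler_sumr.
by apply: eq_bigr => k _; rewrite mxE scalerAr.
Qed.
HB.instance Definition _ := GRing.Lalgebra_isAlgebra.Build R bt bt_scalerAr.

(** Inverses come from classical choice; they make the matrices a [unitAlgType], over which variance
    and invariance quantify. *)
Definition bt_invertible (x : bt) : Prop := exists y, y * x = 1 /\ x * y = 1.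
Definition bt_unit : pred bt := fun x => boolp.asbool (bt_invertible x).
Definition bt_inv (x : bt) : bt :=
  if boolp.pselect (bt_invertible x) is left ex then projT1 (boolp.cid ex) else x.

Fact bt_mulVr : {in bt_unit, left_inverse 1 bt_inv *%R}.
Proof.
move=> x; rewrite unfold_in /bt_inv => /boolp.asboolP ux.
by case: boolp.pselect => // ex; case: boolp.cid => y [].
Qed.
Fact bt_mulrV : {in bt_unit, right_inverse 1 bt_inv *%R}.
Proof.
move=> x; rewrite unfold_in /bt_inv => /boolp.asboolP ux.
by case: boolp.pselect => // ex; case: boolp.cid => y [].
Qed.
Fact bt_unitP x y : y * x = 1 /\ x * y = 1 -> bt_unit x.
Proof. by move=> xy; apply/boolp.asboolP; exists y. Qed.
Fact bt_inv_out : {in [predC bt_unit], bt_inv =1 id}.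
Proof.
move=> x; rewrite inE unfold_in => /boolp.asboolP nux.
by rewrite /bt_inv; case: boolp.pselect.
Qed.
HB.instance Definition _ := GRing.NzRing_hasMulInverse.Build bt
  bt_mulVr bt_mulrV bt_unitP bt_inv_out.

End BlockTriangular.


(** * Weighted paths *)

Lemma sum_tupleS (V : nmodType) (K : finType) n (F : seq K -> V) :
  \sum_(w : n.+1.-tuple K) F w = \sum_(a : K) \sum_(w : n.-tuple K) F (a :: w).
Proof.
rewrite pair_big /= (reindex (fun aw : K * n.-tuple K => cons_tuple aw.1 aw.2)) //=.
exists (fun w : n.+1.-tuple K => (thead w, behead_tuple w)) => [[a w] _|w _] /=.
  by congr (_, _); apply: val_inj.
by apply: val_inj; case/tupleP: w => a w.
Qed.

Section PathSum.
Variables (R : realFieldType) (c d : 'I_8 -> nat -> R) (last : nat).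

(* The weighted number of paths from [i] to [last] whose [w]-labelled steps have
   length 1 (weight [c]) or 2 (weight [d]). *)
Fixpoint path_sum (w : seq 'I_8) (i : nat) : R :=
  if w is a :: w' then c a i * path_sum w' i.+1 + d a i * path_sum w' i.+2
  else (i == last)%:R.

(** Every letter advances the path by at least one. *)
Lemma path_sum_gt w i : (last < i + size w)%N -> path_sum w i = 0.
Proof.
elim: w i => [|a w IHw] i /= li; first by rewrite addn0 in li; rewrite gtn_eqF.
by rewrite !IHw ?mulr0 ?addr0 //; lia.
Qed.

(** The form taken by a matrix entry of the degree [n] part of the series [g]. *)
Definition wsum n (g : seq 'I_8 -> R) i := \sum_(w : n.-tuple 'I_8) g w * path_sum w i.

Lemma wsum0 g i : wsum 0 g i = g [::] * (i == last)%:R.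
Proof.
rewrite /wsum (bigD1 [tuple]) //= big1 ?addr0 // => w.
by move/eqP; rewrite [w]tuple0.
Qed.

Lemma wsumS n g i : wsum n.+1 g i =
  \sum_a (c a i * wsum n (fun w => g (a :: w)) i.+1 + d a i * wsum n (fun w => g (a :: w)) i.+2).
Proof.
rewrite /wsum (@sum_tupleS _ _ _ (fun w => g w * path_sum w i)).
apply: eq_bigr => a _; rewrite !mulr_sumr -big_split; apply: eq_bigr => w _ /=.
by rewrite mulrDr !mulrA ![g _ * _]mulrC.
Qed.

End PathSum.

(** Single steps already reach or pass [last], so a path with a double step overshoots and
    contributes 0. *)
Lemma path_sum_max (R : realFieldType) (c d d' : 'I_8 -> nat -> R) last w i :
  (last <= i + size w)%N -> path_sum c d last w i = path_sum c d' last w i.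
Proof.
elim: w i => [|a w IHw] i //= li.
by rewrite IHw ?addSnnS // !(@path_sum_gt _ _ _ _ w i.+2) ?mulr0 //; lia.
Qed.

Lemma path_sum_short (R : realFieldType) (c : 'I_8 -> nat -> R) last w i :
  (i + size w < last)%N -> path_sum c (fun _ _ => 0) last w i = 0.
Proof.
elim: w i => [|a w IHw] i //= li; last by rewrite IHw ?mul0r ?mulr0 ?addr0 // addSnnS.
by rewrite addn0 in li; rewrite ltn_eqF.
Qed.

Section Detour.
Variables (R : realFieldType) (gam : 'I_8 -> R).

(* The edges of a path carry the letters of [u] and [v], except for one edge without letter
   between them, which can only be crossed by a step of length 2 (weight [dstep2]). The
   weights of these steps are the entries of a commutator with the matrix unit of that edge. *)
Definition detour (u v : seq 'I_8) : seq (option 'I_8) := map Some u ++ None :: map Some v.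
Definition gamo (o : option 'I_8) := if o is Some a then gam a else 0.
Definition dstep1 u v (a : 'I_8) i : R := (nth None (detour u v) i == Some a)%:R.
Definition dstep2 u v (a : 'I_8) i : R := gam a / 2 *
  ((i == size u)%:R * gamo (nth None (detour u v) i.+1)
   - (i.+1 == size u)%:R * gamo (nth None (detour u v) i)).
(** For [side_gam], the vanishing of this sum allows [k3] to be replaced by [k0] at the price of
    [side_sign]. *)
Definition twist (g : seq 'I_8 -> R) u v := \sum_a gam a * g (u ++ a :: v).

Local Notation dsum u v := (wsum (dstep1 u v) (dstep2 u v) (size u + size v).+1).

Lemma sum_dstep1 u v i a (F : 'I_8 -> R) : nth None (detour u v) i = Some a ->
  \sum_b dstep1 u v b i * F b = F a.
Proof.
move=> e; rewrite (bigD1 a) //= /dstep1 e eqxx mul1r big1 ?addr0 // => b.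
by rewrite eq_sym => ba; rewrite -[Some a == _]/(a == b) (negPf ba) mul0r.
Qed.

(** Beyond the unlabelled edge double steps have weight 0 and the single steps must spell [v']. *)
Lemma dsum_tail u v v' g i : (size u < i)%N -> (i + size v' = (size u + size v).+1)%N ->
  (forall k, nth None (detour u v) (i + k)%N = onth v' k) -> dsum u v (size v') g i = g v'.
Proof.
elim: v' g i => [|a v' IHv] g i ui iv Li.
  by rewrite wsum0 -iv addn0 eqxx mulr1.
rewrite wsumS big_split /= (@sum_dstep1 _ _ _ a); last by rewrite -[i]addn0 Li.
have ui1 : (size u < i.+1)%N by apply: ltnW.
 rewrite IHv ?addSnnS //; last by move=> k; rewrite addSnnS Li.
rewrite big1 ?addr0 // => b _; rewrite /dstep2 !gtn_eqF //.
by rewrite !mul0r subrr mulr0 mul0r.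
Qed.

Lemma nth_detour_u u v i : (i < size u)%N -> nth None (detour u v) i = onth u i.
Proof. by move=> iu; rewrite nth_cat size_map iu onthE. Qed.
Lemma nth_detour_p u v : nth None (detour u v) (size u) = None.
Proof. by rewrite nth_cat size_map ltnn subnn. Qed.
Lemma nth_detour_v u v k : nth None (detour u v) ((size u).+1 + k) = onth v k.
Proof.
rewrite nth_cat size_map ltnNge addSn ltnW /= ?ltnS ?leq_addr //.
by rewrite subSn ?leq_addr // addKn /= onthE.
Qed.

(** The unlabelled edge admits no single step, so the first letter jumps over it and over the edge
    of [b]. *)
Lemma dsum_gap u b v g :
  dsum u (b :: v) (size v).+1 g (size u) = 2^-1 * gam b * twist g [::] v.
Proof.
rewrite wsumS mulr_sumr; apply: eq_bigr => a _.
rewrite {1}/dstep1 nth_detour_p mul0r add0r dsum_tail //= ?addSn ?addnS //; last first.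
  by move=> k; have := nth_detour_v u (b :: v) k.+1; rewrite addnS.
rewrite /dstep2 eqxx gtn_eqF // mul0r subr0 mul1r.
by have := nth_detour_v u (b :: v) 0; rewrite addn0 => ->; rewrite /=; field.
Qed.

Lemma dsum_step u1 a u2 v g : u2 != [::] ->
  let u := u1 ++ a :: u2 in
  dsum u v (size u2 + size v).+1 g (size u1) =
  dsum u v (size u2 + size v) (fun w => g (a :: w)) (size u1).+1.
Proof.
move=> u20 u; rewrite wsumS big_split /= (@sum_dstep1 _ _ _ a); last first.
  by rewrite nth_detour_u /u ?size_cat /= ?onthE
    ?map_cat ?nth_cat ?size_map ?ltnn ?subnn //= -addSnnS leq_addr.
rewrite big1 ?addr0 // => b _; rewrite /dstep2 /u size_cat /=.
have : (0 < size u2)%N by rewrite lt0n size_eq0.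
move=> s; have [-> ->] : (size u1 == size u1 + (size u2).+1)%N = false /\
    ((size u1).+1 == size u1 + (size u2).+1)%N = false by split; lia.
by rewrite !mul0r subrr mulr0 mul0r.
Qed.

(** Either [a] is spelled and the next letter jumps over the unlabelled edge and [b], or the first
    letter jumps over [a] and the unlabelled edge; the commutator gives the second case its minus
    sign. *)
Lemma dsum_last u1 a b v g : let u := rcons u1 a in
  dsum u (b :: v) (size v).+2 g (size u1) =
  2^-1 * gam b * twist g [:: a] v - 2^-1 * gam a * twist g [::] (b :: v).
Proof.
move=> u; have su : size u = (size u1).+1 by rewrite size_rcons.
have La : nth None (detour u (b :: v)) (size u1) = Some a.
  by rewrite nth_detour_u ?su // onthE /u map_rcons nth_rcons size_map ltnn eqxx.
rewrite wsumS big_split /= (@sum_dstep1 _ _ _ a) // -su dsum_gap; congr (_ + _).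
rewrite /twist mulr_sumr -sumrN; apply: eq_bigr => a' _.
rewrite (_ : (size v).+1 = size (b :: v)) // dsum_tail //= ?su ?addSnnS ?addnS //; last first.
  by move=> k; rewrite -su nth_detour_v.
by rewrite /dstep2 La su eqxx ltn_eqF //=; field.
Qed.

(** Before the last letter of [u] only single steps have weight, so the prefix is spelled until
    [dsum_last] applies. *)
Lemma dsumE u1 u2 a b v g : let u := u1 ++ rcons u2 a in
  dsum u (b :: v) (size u2 + (size v).+2)%N g (size u1) =
  2^-1 * gam b * twist g (rcons u2 a) v - 2^-1 * gam a * twist g u2 (b :: v).
Proof.
elim: u2 u1 g => [|x u2 IHu] u1 g /=; first by rewrite cats1 dsum_last.
have := @dsum_step u1 x (rcons u2 a) (b :: v) g.
rewrite size_rcons /= addSnnS => -> //; last by rewrite -size_eq0 size_rcons.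
have := IHu (rcons u1 x) (fun w => g (x :: w)); rewrite size_rcons cat_rcons => -> //.
Qed.

(** Taking [b = a0] in [dsumE] trades the last letter of [u] for an [a0] in front of [v]; by
    induction [u] becomes empty, where [dsum_gap] leaves a single term. *)
Lemma twist_eq0 n g a0 (S : pred 'I_8) : gam a0 = 1 -> a0 \in S ->
    (forall u v, all [in S] u -> all [in S] v -> (size u + size v = n.+1)%N ->
     wsum (dstep1 u v) (dstep2 u v) n.+2 n.+1 g 0 = 0) ->
  forall u v, all [in S] u -> all [in S] v -> (size u + size v = n)%N -> twist g u v = 0.
Proof.
move=> ga aS H; elim/last_ind => [|u b IHu] v uS vS /= sz.
  rewrite add0n in sz; have := H [::] (a0 :: v); rewrite /= aS vS add0n sz => /(_ isT isT erefl).
  have := @dsum_gap [::] a0 v g; rewrite /= add0n sz => -> /eqP.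
  by rewrite ga mulr1 mulf_eq0 invr_eq0 pnatr_eq0 => /eqP.
have := H (rcons u b) (a0 :: v); rewrite /= aS vS uS size_rcons.
rewrite size_rcons in sz; rewrite addnS sz => /(_ isT isT erefl).
have := @dsumE [::] u b a0 v g; rewrite /= size_rcons (_ : _ + (size v).+1 = n.+1)%N; last by lia.
rewrite (_ : _ + (size v).+2 = n.+1)%N; last by lia.
move=> ->.
move: uS; rewrite all_rcons => /andP[_ uS].
rewrite (IHu (a0 :: v)) ?uS //=; [|by rewrite aS|by rewrite addnS -addSn].
move/eqP; rewrite mulr0 subr0 ga mulr1 mulf_eq0 invr_eq0 pnatr_eq0 => /eqP //.
Qed.

End Detour.

(** * Invariance at the normal form *)

Section Reduced.
Variables (R : realFieldType) (f : series R) (sd ps : bool).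
Hypothesis var : variant sd ps f.
Variables (A : unitAlgType R) (I : pred A) (N : nat).
Hypothesis nilI : nil_ideal I N.
Variables Q1 Q2 : A.
Hypothesis Q12 : clifford Q1 Q2.

Local Notation P := (cliffP Q1 Q2).
Let Q11 : Q1 * Q1 = -1. Proof. by case: Q12. Qed.
Let Q22 : Q2 * Q2 = -1. Proof. by case: Q12. Qed.
Let Q1U := sqrN1_unit Q11.
Let Q2U := sqrN1_unit Q22.
Let PU := sqrN1_unit (clifford_Psqr Q12).

(** The series at the normal form [A1 = (1 + h) * Q1], [A2 = Q2], without the pseudoscalar
    factor. *)
Definition reduced h := eval_series f N (splitv Q1 Q2 (h * Q1) 0).
Definition fq_unit : A := if ps then Q1 * Q2 else 1.

Lemma fq_unitE : fq_unit = if ps then - P else 1.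
Proof. by rewrite /fq_unit cliffPE opprK. Qed.

Lemma fq_unit_unit : fq_unit \is a GRing.unit.
Proof. by rewrite fq_unitE; case: ps => /=; rewrite ?unitrN ?unitr1 ?PU. Qed.

Lemma fq_eval_reduced h : fq_eval ps f N Q1 Q2 ((1 + h) * Q1) Q2 = reduced h * fq_unit.
Proof. by rewrite /fq_eval mulrDl mul1r addrC addKr subrr. Qed.

Lemma ceq_reduced h : h \in I -> ceq I ((1 + h) * Q1) Q1.
Proof. by move=> hI; rewrite mulrDl mul1r; apply: ceq_add; apply: (nilMr nilI). Qed.

Lemma conj_fq_unit k h : k \is a GRing.unit -> GRing.comm k P ->
  conjby k (h * fq_unit) = conjby k h * fq_unit.
Proof.
move=> kU kP; rewrite conjM //; congr (_ * _); rewrite fq_unitE.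
by case: ps; rewrite ?conjN conj_comm //; apply: commr1.
Qed.

(** The factors [th] and [Q2^-1 * th^-1 * Q2] fix [Q2]; since [th] commutes with [P = Q1 * Q2^-1],
    they conjugate [1 + h] by [th]. *)
Lemma reduced_conj th h : ceq I th 1 -> GRing.comm th P -> h \in I ->
  reduced (conjby th h) = conjby (if sd then Q2^-1 * th * Q2 else th) (reduced h).
Proof.
move=> th1 thP hI; have thU := ceq_unit nilI (unitr1 _) th1.
have thV1 : ceq I th^-1 1 by rewrite -[1]invr1; apply: (ceqV nilI (unitr1 _)).
have t2 : ceq I (Q2^-1 * th^-1 * Q2) 1.
  rewrite -(mulVr Q2U) -[X in ceq _ _ (X * _)]mulr1.
  exact: (ceqM nilI (ceqM nilI (ceq_refl nilI _) thV1) (ceq_refl nilI _)).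
have := var nilI Q12 (ceq_reduced hI) (ceq_refl nilI Q2) th1 t2.
have -> : th * Q2 * (Q2^-1 * th^-1 * Q2) = Q2 by rewrite !mulrA mulrK // mulrV // mul1r.
have -> : th * ((1 + h) * Q1) * (Q2^-1 * th^-1 * Q2) = (1 + conjby th h) * Q1.
  rewrite -[Q1 in LHS](clifford_PQ2 Q12) !mulrA mulrK //.
  have -> : 1 + conjby th h = conjby th (1 + h) by rewrite conjD conj1.
  have thVP : GRing.comm th^-1 P by apply/commr_sym; apply: commrV; apply/commr_sym.
  by rewrite /conjby -(mulrA (th * _) P) -thVP -[Q1 in RHS](clifford_PQ2 Q12) !mulrA.
have -> : (if sd then (Q2^-1 * th^-1 * Q2)^-1 else th) = (if sd then Q2^-1 * th * Q2 else th).
  case: sd => //; have tVU : th^-1 \is a GRing.unit by rewrite unitrV.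
  have Q2VU : Q2^-1 \is a GRing.unit by rewrite unitrV.
  by rewrite invrM ?(unitrMl _ tVU) // (invrM Q2VU tVU) !invrK mulrA.
set k := if sd then _ else _; have kU : k \is a GRing.unit.
  by rewrite /k; case: sd => //; rewrite unitrMl ?Q2U // unitrMr ?unitrV ?Q2U.
have kP : GRing.comm k P.
  rewrite /k; case: sd {k kU} => //.
  have Q2P : Q2 * P = - (P * Q2) by rewrite (clifford_Q2P Q12) (clifford_PQ2 Q12).
  have PQ2 : P * Q2^-1 = - (Q2^-1 * P).
    by apply: (mulrI Q2U); apply: (mulIr Q2U); rewrite mulrN mulNr !mulrA mulrVK // mulrV // mul1r.
  by rewrite /GRing.comm !mulrA PQ2 -!mulrA Q2P !mulrN (mulrA th) thP mulNr -!mulrA.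
rewrite !fq_eval_reduced conj_fq_unit //; exact: (mulIr fq_unit_unit).
Qed.

Hypothesis orth : orth_invariant ps f.
Variables (x t : A).
Hypotheses (xI : x \in I) (x1 : GRing.comm x Q1) (x2 : GRing.comm x Q2).
Hypotheses (tC : forall a, t * a = a * t) (tt : t * t = 0).

(** The rotation of the base is a conjugation; undoing it and restoring [Q2] by variance leads back
    to a normal form. *)
Lemma reduced_orth :
  exists2 u, u \is a GRing.unit &
  [/\ GRing.comm u x, GRing.comm u P &
      reduced x = conjby u (reduced (x + t * x * (2 + x) * P))].
Proof.
have xP : GRing.comm x P by rewrite cliffPE; apply: commrN; apply: commrM.
have tC' a : GRing.comm t a by apply: tC.
pose s := 2^-1 *: t.
have sC a : GRing.comm s a by rewrite /GRing.comm -scalerAl -scalerAr tC.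
have ss : s * s = 0 by rewrite -scalerAl -scalerAr tt !scaler0.
have ts : t * s = 0 by rewrite -scalerAr tt scaler0.
have st : s * t = 0 by rewrite -tC.
have s2 : s + s = t by rewrite -scalerDr scale_half.
have sP2 : s * P * (s * P) = 0.
  by rewrite -(mulrA s) (mulrA P) -(sC P) !mulrA ss !mul0r.
(* Conjugation by [1 - (t / 2) P] is the infinitesimal rotation of [(Q1, Q2)]. *)
pose u := 1 - s * P.
have uU : u \is a GRing.unit.
  apply/unitrP; exists (1 + s * P); rewrite /u; split.
    by rewrite mulrBr mulr1 mulrDl mul1r sP2 addr0 addrK.
  by rewrite mulrDr mulr1 mulrBl mul1r sP2 subr0 subrK.
have ux : GRing.comm u x.
  apply/commr_sym; apply: commrB; first exact: commr1.
  by apply: commrM => //; apply/commr_sym.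
have uP : GRing.comm u P.
  apply/commr_sym; apply: commrB; first exact: commr1.
  by apply: commrM => //; apply/commr_sym.
have tu : t * u = t by rewrite /u mulrBr mulr1 mulrA ts mul0r subr0.
exists u => //; split=> //.
have tuV : t * u^-1 = t by rewrite -{1}tu mulrK.
have tcj a : t * conjby u a = t * a.
  by rewrite /conjby !mulrA tu tC -mulrA tuV -tC.
have sa a b : a * (s * b) = s * (a * b) by rewrite !mulrA -(sC a).
have cQ1 : conjby u Q1 = Q1 + t * Q2.
  apply: (mulIr uU); rewrite /conjby mulrVK // /u mulrBl mulrDl !mulrBr mul1r !mulr1.
  rewrite -mulrA (clifford_PQ1 Q12) mulrN opprK !sa (clifford_Q1P Q12).
  rewrite -(mulrA t) (clifford_Q2P Q12) mulrA st mul0r subr0 -s2 mulrDl.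
  by rewrite -addrA; congr (_ + _); rewrite addrC addrK.
have cQ2 : conjby u Q2 = Q2 - t * Q1.
  apply: (mulIr uU); rewrite /conjby mulrVK // /u !mulrBl !mulrBr mul1r !mulr1.
  rewrite -mulrA (clifford_PQ2 Q12) !sa (clifford_Q2P Q12).
  rewrite -(mulrA t) (clifford_Q1P Q12) (mulrA s t) st mul0r subr0 -s2 mulrDl mulrN opprK.
  by rewrite opprD addrA addrAC -addrA addrA addrK.
pose y := t * x.
have ya a b : GRing.comm x a -> a * (y * b) = y * (a * b).
  by move=> xa; rewrite /y !mulrA -tC -[t * a * x]mulrA -xa !mulrA.
have yy a : y * (y * a) = 0.
  by rewrite /y -!mulrA (mulrA x t) -tC !mulrA tt !mul0r.
have ta a b : a * (t * b) = t * (a * b) by rewrite !mulrA tC.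
have tt0 a : t * (t * a) = 0 by rewrite mulrA tt mul0r.
have yx : y * x = x * y by rewrite /y ta mulrA.
have y1x a : y * ((1 + x) * a) = (y + x * y) * a.
  by rewrite mulrA mulrDr mulr1 yx.
have x1x : GRing.comm x (1 + x) by apply: commrD => //; apply: commr1.
(* The rotated arguments pulled back by this conjugation; they differ from [((1 + x) * Q1, Q2)] by
   multiples of [t * x]. *)
pose B1 := (1 + x) * Q1 - y * Q2; pose B2 := Q2 - y * Q1.
have cx : conjby u x = x by apply: conj_comm.
have ct : conjby u t = t by apply: conj_comm => //; apply/esym/tC.
have cB1 : conjby u B1 = (1 + x) * Q1 + t * Q2.
  rewrite /B1 conjD conjN !conjM // conjD conj1 // cx ct cQ1 cQ2 mulrDr mulrBr.
  rewrite (ta (1 + x)) (ta (t * x)) -![t * x * _]mulrA tt0 subr0.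
  by rewrite [(1 + x) * Q2]mulrDl mul1r mulrDr addrA addrK.
have cB2 : conjby u B2 = Q2 - t * ((1 + x) * Q1).
  rewrite /B2 conjD conjN !conjM // cx ct cQ1 cQ2 mulrDr (ta (t * x)) -![t * x * _]mulrA tt0 addr0.
  by rewrite [(1 + x) * Q1]mulrDl mul1r mulrDr opprD addrA.
have yI : y \in I by apply: (nilMl nilI).
have B1I : ceq I B1 Q1.
  apply: (ceq_trans nilI _ (ceq_reduced xI)); apply: ceq_add.
  by apply: (nilN nilI); apply: (nilMr nilI).
have B2I : ceq I B2 Q2 by apply: ceq_add; apply: (nilN nilI); apply: (nilMr nilI).
have E1 : B1 - (y + x * y) * Q2 = (1 + (x + t * x * (2 + x) * P)) * Q1.
  rewrite addrA [in RHS]mulrDl -mulrA (clifford_PQ1 Q12) mulrN -/y /B1 -addrA -opprD -mulrDl.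
  by rewrite mulrDr yx -[2]/(1 + 1) mulrDr mulr1 addrA.
apply: (mulIr fq_unit_unit); rewrite -conj_fq_unit // -!fq_eval_reduced -E1.
have := orth nilI Q12 (nilMr nilI Q1 xI) (nil0 nilI) tC tt.
have -> : Q1 + x * Q1 = (1 + x) * Q1 by rewrite mulrDl mul1r.
rewrite /= addr0 => ->.
rewrite -cB1 -cB2 -cQ1 -cQ2 fq_eval_conj //; congr (conjby _ _).
(* [B2] is brought back to [Q2] by a factor on the side that does not conjugate the value: on the
   left for right variance, on the right for left variance. *)
case: sd var => v.
  have t1 : ceq I (1 + y * P) 1 by apply: ceq_add; apply: (nilMr nilI).
  have := v _ _ _ nilI _ _ Q12 _ _ _ _ B1I B2I t1 (ceq_refl nilI 1).
  rewrite invr1 /conjby invr1 !mulr1 mul1r => <-.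
  have yPy a : y * P * (y * a) = 0 by rewrite -mulrA ya // yy.
  congr fq_eval; rewrite mulrDl mul1r.
    congr (_ + _); rewrite mulrBr yPy subr0 -mulrA.
    have -> : P * ((1 + x) * Q1) = - ((1 + x) * Q2).
      have xP1 : GRing.comm P (1 + x) by apply: commrD; [apply: commr1|apply/commr_sym].
      by rewrite mulrA xP1 -mulrA (clifford_PQ1 Q12) mulrN.
    by rewrite mulrN y1x.
  by rewrite mulrBr yPy subr0 -mulrA (clifford_PQ2 Q12) subrK.
have t2 : ceq I (1 - y * P) 1 by apply: ceq_add; apply: (nilN nilI); apply: (nilMr nilI).
have := v _ _ _ nilI _ _ Q12 _ _ _ _ B1I B2I (ceq_refl nilI 1) t2.
rewrite /conjby invr1 !mulr1 !mul1r => <-.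
have yay a b : GRing.comm x a -> y * a * (y * b) = 0 by move=> xa; rewrite -mulrA ya // yy.
congr fq_eval; rewrite mulrBr mulr1.
  congr (_ - _); rewrite mulrBl yay // subr0 ya; last by apply: commrM.
  by rewrite -[_ * Q1 * P]mulrA (clifford_Q1P Q12) y1x.
by rewrite mulrBl yay // subr0 ya // (clifford_Q2P Q12) mulrN opprK subrK.
Qed.

End Reduced.

(** * Entries and the nilpotent ideal of block triangular matrices *)

Section Entries.
Variables (R : realFieldType) (B : algType R) (m : nat).
Variables (lv : nat -> nat) (T : 'M[B]_m.+1).
Local Notation A := (bt lv T).
Implicit Types (x y : A) (i l : 'I_m.+1).

Lemma btP x y : (forall i l, x i l = y i l) -> x = y.
Proof. by move=> xy; apply/val_inj/matrixP. Qed.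
Lemma btDE x y i l : (x + y) i l = x i l + y i l. Proof. by rewrite mxE. Qed.
Lemma btNE x i l : (- x) i l = - x i l. Proof. by rewrite mxE. Qed.
Lemma bt0E i l : (0 : A) i l = 0. Proof. by rewrite mxE. Qed.
Lemma btZE c x i l : (c *: x) i l = c *: x i l. Proof. by rewrite mxE. Qed.
Lemma btME x y i l : (x * y) i l = \sum_k x i k * y k l. Proof. by rewrite mxE. Qed.
Lemma bt1E i l : (1 : A) i l = (i == l)%:R. Proof. by rewrite mxE. Qed.
Lemma bt_sumE (J : Type) (s : seq J) (p : pred J) (F : J -> A) i l :
  (\sum_(j <- s | p j) F j) i l = \sum_(j <- s | p j) F j i l.
Proof.
apply: (big_morph (fun x : A => x i l)) => [x y|]; [exact: btDE | exact: bt0E].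
Qed.

Definition bt_ideal : pred A :=
  [pred x : A | [forall i : 'I_m.+1, forall l : 'I_m.+1, (lv l <= lv i)%N ==> (x i l == 0)]].

Lemma bt_idealP x :
  reflect (forall i l, (lv l <= lv i)%N -> x i l = 0) (x \in bt_ideal).
Proof.
apply: (iffP forallP) => [h i l il|h i].
  by have /forallP/(_ l)/implyP/(_ il)/eqP := h i.
by apply/forallP=> l; apply/implyP=> il; rewrite h.
Qed.

Lemma bt_tri x i l : (lv l < lv i)%N -> x i l = 0.
Proof. by case: x => M /= /bt_predP[+ _]; apply. Qed.

(** Each factor raises the level by at least one. *)
Lemma bt_ideal_prod (s : seq A) i l : all (fun x => x \in bt_ideal) s ->
  (lv l < lv i + size s)%N -> (\prod_(x <- s) x) i l = 0.
Proof.
elim: s i => [|x s IHs] i /=.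
  by move=> _; rewrite addn0 => il; apply: bt_tri.
case/andP=> xI sI il; rewrite big_cons btME big1 // => k _.
have [ki|ik] := leqP (lv k) (lv i); first by rewrite (bt_idealP _ xI) // mul0r.
by rewrite IHs ?mulr0 //; lia.
Qed.

Lemma bt_nil N : (forall i, lv i < N)%N -> nil_ideal bt_ideal N.
Proof.
move=> lvN; split.
- by apply/bt_idealP=> i l _; rewrite bt0E.
- move=> x y /bt_idealP x0 /bt_idealP y0; apply/bt_idealP=> i l il.
  by rewrite btDE btNE x0 // y0 // subrr.
- move=> c x /bt_idealP x0; apply/bt_idealP=> i l il.
  by rewrite btZE x0 // scaler0.
- move=> a x /bt_idealP x0; split; apply/bt_idealP=> i l il; rewrite btME big1 // => k _.
    have [ki|ik] := ltnP (lv k) (lv i); first by rewrite bt_tri // mul0r.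
    by rewrite x0 ?mulr0 // (leq_trans il).
  have [ki|ik] := leqP (lv k) (lv i); first by rewrite x0 // mul0r.
  by rewrite (@bt_tri a k l) ?mulr0 // (leq_ltn_trans il).
move=> s sI; apply: btP => i l; rewrite bt0E bt_ideal_prod // size_tuple.
by rewrite (leq_trans (lvN l)) // leq_addl.
Qed.

Hypothesis TC : forall i l b, b * T i l = T i l * b.

Lemma bt_diag_subproof b : b%:M \in bt_pred lv T.
Proof.
apply/bt_predP; split.
  by move=> i l il; rewrite mxE; case: eqP il => [->|//]; rewrite ltnn.
apply/matrixP=> i l; rewrite !mxE (bigD1 l) //= big1 => [|k kl]; last first.
  by rewrite mxE (negPf kl) mulr0.
rewrite (bigD1 i) //= big1 => [|k ki]; last first.
  by rewrite mxE eq_sym (negPf ki) mul0r.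
by rewrite !mxE !eqxx !addr0 TC.
Qed.
(** A copy of [B] inside the matrix algebra, in which the Clifford systems are taken. *)
Definition bt_diag b : A := Bt (bt_diag_subproof b).

Lemma bt_diagE b i l : bt_diag b i l = if i == l then b else 0.
Proof. by rewrite mxE mulrb. Qed.
Lemma bt_diagMl b x i l : (bt_diag b * x) i l = b * x i l.
Proof.
rewrite btME (bigD1 i) //= big1 => [|k ki]; last first.
  by rewrite bt_diagE eq_sym (negPf ki) mul0r.
by rewrite bt_diagE eqxx addr0.
Qed.
Lemma bt_diagMr b x i l : (x * bt_diag b) i l = x i l * b.
Proof.
rewrite btME (bigD1 l) //= big1 => [|k ki]; last first.
  by rewrite bt_diagE (negPf ki) mulr0.
by rewrite bt_diagE eqxx addr0.
Qed.
Lemma bt_diagM a b : bt_diag (a * b) = bt_diag a * bt_diag b.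
Proof. by apply: btP => i l; rewrite bt_diagMl !bt_diagE; case: eqP; rewrite ?mulr0. Qed.
Lemma bt_diagD a b : bt_diag (a + b) = bt_diag a + bt_diag b.
Proof. by apply: btP => i l; rewrite btDE !bt_diagE; case: eqP; rewrite ?addr0. Qed.
Lemma bt_diagN a : bt_diag (- a) = - bt_diag a.
Proof. by apply: btP => i l; rewrite btNE !bt_diagE; case: eqP; rewrite ?oppr0. Qed.
Lemma bt_diag1 : bt_diag 1 = 1.
Proof. by apply: btP => i l; rewrite bt_diagE. Qed.

Lemma bt_diag_clifford q1 q2 : q1 * q1 = -1 -> q2 * q2 = -1 -> q1 * q2 = - (q2 * q1) ->
  clifford (bt_diag q1) (bt_diag q2).
Proof.
by move=> q11 q22 q12; split; rewrite -!bt_diagM ?q11 ?q22 ?q12 bt_diagN ?bt_diag1.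
Qed.

Lemma sum_ord_delta (k : nat) (g : nat -> R) : (forall l : nat, (m < l)%N -> g l = 0) ->
  \sum_(l < m.+1) (l == k :> nat)%:R * g l = g k.
Proof.
move=> g0; have [km|mk] := ltnP k m.+1.
  rewrite (bigD1 (Ordinal km)) //= eqxx mul1r big1 ?addr0 // => l lk.
  by move: lk; rewrite -val_eqE /= => /negPf ->; rewrite mul0r.
rewrite g0 // big1 // => l _; rewrite ltn_eqF ?mul0r //.
by apply: leq_trans (ltn_ord l) mk.
Qed.

(** The matrix product expands into a sum over paths; all carry the same product of the [om a], and
    the real weights add up to [path_sum]. *)
Lemma prod_path (M : 'I_8 -> A) (om : 'I_8 -> B) (c d : 'I_8 -> nat -> R) :
    (forall a i l, M a i l = ((l == i.+1 :> nat)%:R * c a i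
                              + (l == i.+2 :> nat)%:R * d a i) *: om a) ->
  forall w i l, (\prod_(a <- w) M a) i l = path_sum c d l w i *: \prod_(a <- w) om a.
Proof.
move=> ME w i l; elim: w i => [|a w IHw] i.
  by rewrite !big_nil bt1E /= scaler_nat -[i == l]/(i == l :> nat); case: eqP.
rewrite !big_cons btME /=.
transitivity (\sum_(k < m.+1) (((k == i.+1 :> nat)%:R * (c a i * path_sum c d l w k)) +
   ((k == i.+2 :> nat)%:R * (d a i * path_sum c d l w k))) *: (om a * \prod_(a <- w) om a)).
  apply: eq_bigr => k _; rewrite ME IHw -scalerAl -scalerAr scalerA; congr (_ *: _).
  by ring.
rewrite -scaler_suml big_split /=; congr (_ *: _).
have g0 k : (m < k)%N -> path_sum c d l w k = 0.
  move=> mk; apply: path_sum_gt; rewrite (leq_trans _ (leq_addr _ _)) //.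
  by rewrite (leq_trans (ltn_ord l)).
by congr (_ + _);
   rewrite (sum_ord_delta _ (g := fun k => _ * path_sum c d l w k)) // => k mk;
   rewrite g0 // mulr0.
Qed.

End Entries.
Arguments bt_ideal {R B m} lv T.
Arguments bt_diag {R B m} lv {T} TC b.

(** * A detour in a path of matrices *)

(** The sign s in [h_00 + s h_11]. *)
Definition side_sign (R : realFieldType) (sd : bool) : R := if sd then -1 else 1.
(** The proportions in which the detour conjugation changes the r_1 and r_4 parts of [h]. *)
Definition side_gam (R : realFieldType) (sd : bool) (a : 'I_8) : R :=
  if a == k0 then 1 else if a == k3 then - side_sign R sd else 0.

Lemma side_signK (R : realFieldType) sd : side_sign R sd * side_sign R sd = 1.
Proof. by case: sd; rewrite /side_sign ?mulrNN mulr1. Qed.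

Section DetourConj.
Variables (R : realFieldType) (A : unitAlgType R) (E s d J : A) (sg : R).
Hypotheses (JE : GRing.comm J E) (Js : GRing.comm J s) (Jd : GRing.comm J d).
Hypotheses (JJ : J * J = 1) (EE : E * E = 0) (EsE : E * s * E = 0) (EdE : E * d * E = 0).
Hypothesis sgK : sg * sg = 1.

(** For [c = sg], the idempotent on which the involution [J] acts as [- sg]. *)
Definition half_proj (c : R) : A := 2^-1 *: (1 - c *: J).
Definition commutator_twist : A := E * (s - sg *: d) - (s - sg *: d) * E.

Lemma half_projJ : J * half_proj sg = - sg *: half_proj sg.
Proof.
rewrite /half_proj -scalerAr scalerA mulrC -scalerA; congr (_ *: _).
by rewrite mulrBr mulr1 -scalerAr JJ scalerBr scalerA mulNr sgK scaleN1r opprK addrC scaleNr.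
Qed.

Lemma half_proj_comm x : GRing.comm J x -> GRing.comm x (half_proj sg).
Proof.
move=> Jx; rewrite /half_proj /GRing.comm -scalerAl -scalerAr; congr (_ *: _).
apply: commrB; first exact: commr1.
by rewrite /GRing.comm -scalerAl -scalerAr Jx.
Qed.

Let e := E * half_proj sg.

Lemma detour_sqr0 : e * e = 0.
Proof.
have Ek := half_proj_comm JE.
by rewrite /e mulrA -(mulrA E) -Ek mulrA EE !mul0r.
Qed.

Lemma detour_unit : 1 + e \is a GRing.unit.
Proof.
apply/unitrP; exists (1 - e); split.
  by rewrite mulrDr mulr1 mulrBl mul1r detour_sqr0 subr0 subrK.
by rewrite mulrBr mulr1 mulrDl mul1r detour_sqr0 addr0 addrK.
Qed.

Lemma detour_inv : (1 + e)^-1 = 1 - e.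
Proof.
apply: (mulrI detour_unit); rewrite mulrV ?detour_unit //.
by rewrite mulrBr mulr1 mulrDl mul1r detour_sqr0 addr0 addrK.
Qed.

(** Since [e * e = 0] and [e * (s + d * J) * e = 0], conjugation only adds the commutator with [e].
    This is [commutator_twist] times the idempotent, whose two terms feed the parts without and with
    [J]. *)
Lemma detour_conj : conjby (1 + e) (s + d * J) =
  (s + 2^-1 *: commutator_twist) + (d - (2^-1 * sg) *: commutator_twist) * J.
Proof.
set k := half_proj sg; have Jk : J * k = - sg *: k := half_projJ.
have Ek : GRing.comm E k := half_proj_comm JE.
have sk : GRing.comm s k := half_proj_comm Js.
have dk : GRing.comm d k := half_proj_comm Jd.
have kJ : k * J = J * k by apply/esym/half_proj_comm.
have eE : e = E * k by []; have kE : k = half_proj sg by [].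
clearbody k.
have eh : e * (s + d * J) = E * (s - sg *: d) * k.
  rewrite eE -mulrA -[RHS]mulrA; congr (_ * _).
  rewrite mulrDr -sk [k * (d * J)]mulrA -dk -[d * k * J]mulrA.
  rewrite mulrBl -[sg *: d * k]scalerAl -scaleNr; congr (_ + _).
  by rewrite kJ Jk -scalerAr.
have he : (s + d * J) * e = (s - sg *: d) * E * k.
  rewrite eE !mulrDl -[d * J * _]mulrA [J * _]mulrA JE -[E * J * _]mulrA Jk.
  by rewrite !mulNr -!scalerAl scaleNr !mulrN -!scalerAr !mulrA.
have ehe : e * (s + d * J) * e = 0.
  have kEk : k * (E * k) = E * (k * k) by rewrite !mulrA Ek.
  rewrite eh eE -mulrA kEk mulrA [E * (_ - _)]mulrBr mulrBl EsE -scalerAr -scalerAl EdE.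
  by rewrite scaler0 subr0 mul0r.
rewrite /conjby detour_inv mulrBr mulr1 [(1 + e) * _]mulrDl mul1r mulrDl ehe addr0 he eh.
rewrite -addrA -mulrBl -/commutator_twist kE /half_proj -scalerAr mulrBr mulr1 -scalerAr.
by rewrite scalerBr scalerA [(d - _) * J]mulrBl -[_ *: _ * J]scalerAl addrACA.
Qed.

End DetourConj.

Section PathModel.
Variables (R : realFieldType) (B : algType R) (m : nat).

(** [T = 0] makes the commutation condition empty, leaving all upper triangular matrices. *)
Let T0 : 'M[B]_m.+1 := 0.
Local Notation A := (bt id T0).

Lemma pathT i l b : b * T0 i l = T0 i l * b.
Proof. by rewrite mxE mulr0 mul0r. Qed.

Lemma path_mx_subproof (c : nat -> nat -> B) :
  \matrix_(i < m.+1, l < m.+1) (if (i <= l)%N then c i l else 0) \in bt_pred id T0.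
Proof.
apply/bt_predP; rewrite mul0mx mulmx0; split=> // i l il.
by rewrite mxE leqNgt il.
Qed.
Definition path_mx c : A := Bt (path_mx_subproof c).

Lemma path_mxE c (i l : 'I_m.+1) : path_mx c i l = if (i <= l)%N then c i l else 0.
Proof. by rewrite mxE. Qed.

Definition step_mx (c : nat -> B) : A := path_mx (fun i l => if l == i.+1 then c i else 0).

Lemma step_mxE c (i l : 'I_m.+1) : step_mx c i l = if l == i.+1 :> nat then c i else 0.
Proof. by rewrite path_mxE; case: eqP => [->|_]; rewrite ?leqnSn ?if_same. Qed.

Lemma step_mx_ideal c : step_mx c \in bt_ideal id T0.
Proof. by apply/bt_idealP=> i l il; rewrite step_mxE ltn_eqF. Qed.

Lemma path_nil : nil_ideal (bt_ideal id T0) m.+1.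
Proof. by apply: bt_nil => i; apply: ltn_ord. Qed.

End PathModel.

(** * Relations between coefficients forced by variance *)

Definition vanish03_lt (R : realFieldType) n (f : series R) : Prop :=
  forall w : seq 'I_8, (0 < size w < n)%N -> all [in pred2 k0 k3] w -> f w = 0.

Section TwistVanish.
Variables (R : realFieldType) (B : algType R) (q1 q2 j : B).
Hypotheses (q11 : q1 * q1 = -1) (q22 : q2 * q2 = -1) (q12 : q1 * q2 = - (q2 * q1)).
Hypotheses (jj : j * j = 1) (j1 : j * q1 = - (q1 * j)) (j2 : j * q2 = - (q2 * j)).
Hypothesis j_neq : 1 + j != 0.

Variables (f : series R) (sd ps : bool) (n : nat).
Hypotheses (var : variant sd ps f) (f03 : vanish03_lt n.+1 f).

Local Notation m := n.+2.
Local Notation A := (bt id (0 : 'M[B]_m.+1)).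
Local Notation I := (bt_ideal id (0 : 'M[B]_m.+1)).
Local Notation dg := (bt_diag id (@pathT R B m)).
Local Notation sg := (side_sign R sd).
Local Notation gam := (side_gam R sd).

Section Word.
Variables u v : seq 'I_8.
Hypotheses (u03 : all [in pred2 k0 k3] u) (v03 : all [in pred2 k0 k3] v).
Hypothesis uv : (size u + size v = n.+1)%N.

Local Notation L := (detour u v).
Local Notation p := (size u).
Let c := dstep1 R u v.
Let d := dstep2 gam u v.
(** The matrix unit of the unlabelled edge; [s] and [d0] carry the single steps along the edges
    labelled [k0] and [k3]. *)
Let E : A := path_mx _ (fun i l => ((i == p) && (l == p.+1))%:R).
Let s : A := step_mx m (fun i => (c k0 i)%:A).
Let d0 : A := step_mx m (fun i => (c k3 i)%:A).
Let J : A := dg j.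
Let Y := s - sg *: d0.
Let D := commutator_twist E s d0 sg.
Let gL i := gamo gam (nth None L i).

Let pm : (p.+1 < m.+1)%N. Proof. by lia. Qed.

Lemma detour03 i a : nth None L i = Some a -> a \in pred2 k0 k3.
Proof.
move=> La; have : Some a \in L.
  rewrite -La mem_nth // ltnNge; apply/negP => h.
  by move: La; rewrite nth_default.
rewrite mem_cat inE /= => /orP[] /mapP[b bw [->]].
  exact: (allP u03).
exact: (allP v03).
Qed.

Let EE0 (i l : 'I_m.+1) : E i l = ((i == p :> nat) && (l == p.+1 :> nat))%:R.
Proof.
by rewrite path_mxE; case: andP => [[/eqP-> /eqP->]|_]; rewrite ?leqnSn ?if_same.
Qed.

Let EM (x : A) (i l : 'I_m.+1) : (E * x) i l = if i == p :> nat then x (Ordinal pm) l else 0.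
Proof.
rewrite btME (bigD1 (Ordinal pm)) //= big1 ?addr0 => [|k kp].
  by rewrite EE0 eqxx andbT; case: eqP; rewrite ?mul1r ?mul0r.
by rewrite EE0 -[k == _ :> nat]/(k == Ordinal pm) (negPf kp) andbF mul0r.
Qed.

Let ME (x : A) (i l : 'I_m.+1) :
  (x * E) i l = if l == p.+1 :> nat then x i (Ordinal (ltnW pm)) else 0.
Proof.
rewrite btME (bigD1 (Ordinal (ltnW pm))) //= big1 ?addr0 => [|k kp].
  by rewrite EE0 eqxx /=; case: eqP; rewrite ?mulr1 ?mulr0.
by rewrite EE0 -[k == _ :> nat]/(k == Ordinal (ltnW pm)) (negPf kp) mulr0.
Qed.

Let EE : E * E = 0.
Proof.
apply: btP => i l; rewrite EM bt0E; case: eqP => // _.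
by rewrite EE0 /= gtn_eqF.
Qed.

Let EME x : E * x * E = 0.
Proof.
apply: btP => i l; rewrite ME EM bt0E; case: eqP => // _; case: eqP => // _.
exact: bt_tri.
Qed.

Let YE (i l : 'I_m.+1) : Y i l = ((l == i.+1 :> nat)%:R * gL i)%:A.
Proof.
rewrite btDE btNE btZE !step_mxE; case: eqP => _; last by rewrite mul0r scale0r scaler0 subr0.
rewrite mul1r scalerA -scalerBl; congr (_ *: _).
rewrite /gL /c /dstep1; case La: (nth None L i) => [a|] /=; last by rewrite mulr0 subr0.
have := detour03 La; rewrite !inE => /orP[] /eqP ->;
  rewrite /side_gam /= ?mulr0 ?subr0 ?mulr1 ?sub0r //.
Qed.

Let DE (i l : 'I_m.+1) : D i l = ((l == i.+2 :> nat)%:R *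
  ((i == p :> nat)%:R * gL i.+1 - (i.+1 == p)%:R * gL i))%:A.
Proof.
rewrite /D /commutator_twist -/Y btDE btNE EM ME !YE /=.
have -> : (if i == p :> nat then ((l == p.+2 :> nat)%:R * gL p.+1)%:A else 0) =
    ((l == i.+2 :> nat)%:R * ((i == p :> nat)%:R * gL i.+1))%:A :> B.
  by case: eqP => [->|_]; rewrite ?mul1r // mul0r mulr0 scale0r.
have -> : (if l == p.+1 :> nat then ((p == i.+1)%:R * gL i)%:A else 0) =
    ((l == i.+2 :> nat)%:R * ((i.+1 == p)%:R * gL i))%:A :> B.
  rewrite [p == _]eq_sym; case: (i.+1 =P p) => [<-|_].
    by rewrite mul1r; case: eqP; rewrite ?mul1r ?mul0r ?scale0r.
  by rewrite mul0r mulr0 scale0r if_same.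
by rewrite mulrBr scalerBl.
Qed.

Let JR (x : A) : (forall i l, exists r, x i l = r%:A) -> forall b, GRing.comm (dg b) x.
Proof.
move=> xr b; apply: btP => i l; rewrite bt_diagMl bt_diagMr.
by have [r ->] := xr i l; rewrite mulr_algl mulr_algr.
Qed.

Let E_R (i l : 'I_m.+1) : exists r, E i l = r%:A.
Proof. by exists ((i == p :> nat) && (l == p.+1 :> nat))%:R; rewrite EE0 scaler_nat. Qed.
Let step_R (g : nat -> R) (i l : 'I_m.+1) : exists r, step_mx m (fun i => (g i)%:A : B) i l = r%:A.
Proof. by rewrite step_mxE; case: ifP => _; [exists (g i)|exists 0; rewrite scale0r]. Qed.
Let D_R (i l : 'I_m.+1) : exists r, D i l = r%:A.
Proof. by rewrite DE; eexists. Qed.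

Let JE b : GRing.comm (dg b) E := JR E_R b.
Let Js b : GRing.comm (dg b) s := JR (step_R _) b.
Let Jd b : GRing.comm (dg b) d0 := JR (step_R _) b.
Let JD b : GRing.comm (dg b) D := JR D_R b.
Let JJ : J * J = 1. Proof. by rewrite /J -bt_diagM jj bt_diag1. Qed.

Let Q1 : A := dg q1.
Let Q2 : A := dg q2.
Let Q12 : clifford Q1 Q2 := bt_diag_clifford _ _ q11 q22 q12.
Let nilI : nil_ideal I m.+1 := path_nil B m.
Let Z0 := d0 * J.
(** As [J] anticommutes with [Q1] and [Q2], the summands are the values of r_1 and r_4. *)
Let h := s + Z0.
Let X := s + 2^-1 *: D.
Let Z := (d0 - (2^-1 * sg) *: D) * J.
Let th := 1 + E * half_proj J sg.
Let h' := conjby th h.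

Let J1 : J * Q1 = - (Q1 * J). Proof. by rewrite /J /Q1 -!bt_diagM j1 bt_diagN. Qed.
Let J2 : J * Q2 = - (Q2 * J). Proof. by rewrite /J /Q2 -!bt_diagM j2 bt_diagN. Qed.

Let h'E : h' = X + Z.
Proof. exact: (detour_conj (JE j) (Js j) (Jd j) JJ EE (EME s) (EME d0) (side_signK R sd)). Qed.

Let parX b x : GRing.comm (dg b) x -> qpar false (dg b) x.
Proof. by rewrite /qpar => <-. Qed.
Let parZ b x : GRing.comm (dg b) x -> J * dg b = - (dg b * J) -> qpar true (dg b) (x * J).
Proof. by move=> bx Jb; rewrite /qpar -mulrA Jb mulrN !mulrA bx. Qed.

Let h_split : splitv Q1 Q2 (h * Q1) 0 =1 split_pair s Z0.
Proof. by apply: splitv_pair => //; [apply: parX|apply: parX|apply: parZ|apply: parZ]. Qed.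

Let h'_split : splitv Q1 Q2 (h' * Q1) 0 =1 split_pair X Z.
Proof.
have cX b : GRing.comm (dg b) X.
  by apply: commrD => //; rewrite /GRing.comm -scalerAl -scalerAr JD.
have cZ b : GRing.comm (dg b) (d0 - (2^-1 * sg) *: D).
  by apply: commrB => //; rewrite /GRing.comm -scalerAl -scalerAr JD.
by rewrite h'E; apply: splitv_pair => //; [apply: parX|apply: parX|apply: parZ|apply: parZ].
Qed.

Let om (a : 'I_8) : B := if a == k3 then j else 1.

Let not03 a i : a \notin pred2 k0 k3 -> (c a i = 0) * (d a i = 0).
Proof.
move=> a03; split.
  by rewrite /c /dstep1; case: eqP => // /detour03; rewrite (negPf a03).
move: a03; rewrite !inE negb_or => /andP[/negPf a0 /negPf a3].
by rewrite /d /dstep2 {1}/side_gam a0 a3 !mul0r.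
Qed.

Let hM a (i l : 'I_m.+1) : split_pair s Z0 a i l =
  ((l == i.+1 :> nat)%:R * c a i + (l == i.+2 :> nat)%:R * 0) *: om a.
Proof.
rewrite mulr0 addr0; have [->|a0] := eqVneq a k0.
  rewrite -[split_pair _ _ _]/s -[om k0]/1 step_mxE.
  by case: eqP; rewrite ?mul1r ?mul0r ?scale0r.
have [->|a3] := eqVneq a k3.
  rewrite -[split_pair _ _ _]/Z0 -[om k3]/j bt_diagMr step_mxE.
  by case: eqP; rewrite ?mul1r ?mul0r ?scale0r // mulr_algl.
rewrite /split_pair (negPf a0) (negPf a3) bt0E.
by rewrite not03 ?mulr0 ?scale0r // !inE negb_or a0.
Qed.

Let h'M a (i l : 'I_m.+1) : split_pair X Z a i l =
  ((l == i.+1 :> nat)%:R * c a i + (l == i.+2 :> nat)%:R * d a i) *: om a.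
Proof.
have one k (r i' l' : nat) :
    (if l' == i' then (c k r)%:A else 0) = ((l' == i')%:R * c k r)%:A :> B.
  by case: eqP; rewrite ?mul1r ?mul0r ?scale0r.
have [->|a0] := eqVneq a k0.
  rewrite -[split_pair _ _ _]/X -[om k0]/1 btDE btZE step_mxE DE scalerA one.
  rewrite -scalerDl; congr (_ *: _).
  by rewrite /d /dstep2 -!/(gL _) -[gam k0]/1; field.
have [->|a3] := eqVneq a k3.
  rewrite -[split_pair _ _ _]/Z -[om k3]/j bt_diagMr btDE btNE btZE step_mxE DE scalerA one.
  rewrite -scalerBl mulr_algl; congr (_ *: _).
  by rewrite /d /dstep2 -!/(gL _) -[gam k3]/(- sg); field.
rewrite /split_pair (negPf a0) (negPf a3) bt0E.
by rewrite !not03 ?mulr0 ?addr0 ?scale0r // !inE negb_or a0.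
Qed.

Let thI : ceq I th 1.
Proof.
apply: ceq_add; apply: (nilMr nilI); apply/bt_idealP => i l li; rewrite EE0.
by case: eqP => //= ip; case: eqP => // lp; move: li; rewrite ip lp ltnn.
Qed.

Let thU : th \is a GRing.unit := ceq_unit nilI (unitr1 _) thI.

Let hI : h \in I.
Proof.
by apply: (nilD nilI); [|apply: (nilMr nilI)]; apply: step_mx_ideal.
Qed.

Let kap := if sd then Q2^-1 * th * Q2 else th.

Let Q2U : Q2 \is a GRing.unit. Proof. by apply: sqrN1_unit; case: Q12. Qed.

(** In both cases [kap] is [1 + E * (1 - J) / 2], since [Q2] anticommutes with [J]; and [1 + J]
    annihilates [1 - J]. *)
Let projk : (1 + J) * kap = 1 + J.
Proof.
have JE1 : GRing.comm (1 + J) E.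
  by apply/commr_sym; apply: commrD; [apply: commr1|apply: (commr_sym (JE j))].
have key : (1 + J) * (E * half_proj J 1) = 0.
  rewrite mulrA JE1 -mulrA /half_proj -scalerAr scale1r mulrBr mulr1 mulrDl mul1r JJ.
  by rewrite [J + 1]addrC subrr scaler0 mulr0.
suff -> : kap = 1 + E * half_proj J 1 by rewrite mulrDr mulr1 key addr0.
rewrite /kap /th /half_proj /side_sign; case: sd => //.
apply: (mulrI Q2U); rewrite !mulrA mulrV // mul1r mulrDl mulrDr mul1r mulr1; congr (_ + _).
rewrite mulrA (JE q2) -!mulrA; congr (_ * _); rewrite -scalerAl -scalerAr; congr (_ *: _).
by rewrite mulrBl mulrBr mul1r mulr1 scaleN1r scale1r mulNr J2 opprK.
Qed.

Let thP : GRing.comm th (cliffP Q1 Q2).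
Proof.
apply/commr_sym; rewrite /th; apply: commrD; first exact: commr1.
have JP : GRing.comm J (cliffP Q1 Q2).
  rewrite cliffPE; apply: commrN.
  by rewrite /GRing.comm mulrA J1 mulNr -mulrA J2 mulrN opprK mulrA.
have EP : GRing.comm (cliffP Q1 Q2) E.
  by rewrite cliffPE; apply/commr_sym; apply: commrN;
    apply: commrM; apply/commr_sym; apply: JE.
by apply: commrM => //; apply: half_proj_comm.
Qed.

Let J_reduced : GRing.comm J (reduced f m.+1 Q1 Q2 h).
Proof.
rewrite /reduced (eq_eval_series _ _ h_split) /eval_series.
apply: commr_sum => k _; apply: commr_sum => w _.
rewrite /GRing.comm -scalerAl -scalerAr; congr (_ *: _).
apply: commr_prod => a _; rewrite /split_pair.
case: (a == k0); first exact: (Js j).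
case: (a == k3); last exact: commr0.
by apply: commrM => //; apply: (Jd j).
Qed.

(** The factor [1 + J] makes conjugation by [kap] invisible, as [J] commutes with the value at
    [h]. *)
Let reduced_eq : (1 + J) * (reduced f m.+1 Q1 Q2 h' - reduced f m.+1 Q1 Q2 h) = 0.
Proof.
have kU : kap \is a GRing.unit.
  by rewrite /kap; case: sd => //; rewrite unitrMl ?Q2U // unitrMr ?unitrV ?Q2U.
rewrite (reduced_conj var nilI Q12 thI thP hI) -/kap mulrBr; apply/eqP; rewrite subr_eq0; apply/eqP.
have J1r : GRing.comm (1 + J) (reduced f m.+1 Q1 Q2 h).
  by apply/commr_sym; apply: commrD; [apply: commr1|apply/commr_sym].
by rewrite /conjby !mulrA projk J1r -mulrA -{1}projk mulrK.
Qed.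

(** As [(1 + j) * j = 1 + j], the factor [1 + j] absorbs the product of [om] over any word. *)
Let hom_entry (x : 'I_8 -> A) (g : 'I_8 -> nat -> R) k :
    (forall a (i l : 'I_m.+1), x a i l =
      ((l == i.+1 :> nat)%:R * c a i + (l == i.+2 :> nat)%:R * g a i) *: om a) ->
  (1 + j) * (hom_series f k x : A) ord0 ord_max = wsum c g m k f 0 *: (1 + j).
Proof.
move=> xE; rewrite bt_sumE /wsum mulr_sumr scaler_suml; apply: eq_bigr => w _.
rewrite btZE (prod_path xE) -!scalerAr scalerA; congr (_ *: _).
elim: (tval w) => [|a w' IHw]; first by rewrite big_nil mulr1.
rewrite big_cons mulrA -[RHS]IHw; congr (_ * _).
by rewrite /om; case: ifP => _; rewrite ?mulr1 // mulrDl mul1r jj addrC.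
Qed.

Lemma detour_sum_eq0 : wsum c d m n.+1 f 0 = 0.
Proof.
(* With truncation at [n + 3] and no coefficients in degrees 1 to [n], only degrees 0, [n + 1] and
   [n + 2] remain. *)
have mid (x : 'I_8 -> A) : (forall a, a \notin pred2 k0 k3 -> x a = 0) ->
    eval_series f m.+1 x = (f [::])%:A + (hom_series f n.+1 x + hom_series f n.+2 x).
  move=> x0; rewrite /eval_series 2!big_ord_recr /= -addrA; congr (_ + _).
  rewrite big_ord_recl -/(hom_series _ _ _) hom_series0 big1 ?addr0 // => k _.
  by apply: hom_series_eq0 => // w sw; apply: f03; rewrite sw /= ltnS.
have sp0 (x y : A) a : a \notin pred2 k0 k3 -> split_pair x y a = 0.
  by rewrite /split_pair !inE negb_or => /andP[/negPf-> /negPf->].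
have := reduced_eq; rewrite /reduced (eq_eval_series _ _ h_split) (eq_eval_series _ _ h'_split).
rewrite !mid; [|by move=> a /sp0..].
rewrite opprD addrACA subrr add0r opprD addrACA.
have -> : 1 + J = dg (1 + j) by rewrite bt_diagD bt_diag1.
move=> /(congr1 (fun x : A => x ord0 ord_max)); rewrite bt_diagMl bt0E.
rewrite !(btDE, btNE) !(mulrDr, mulrN).
rewrite !(hom_entry _ h'M) !(@hom_entry _ (fun=> fun=> 0) _ hM) -!scalerBl -scalerDl => /eqP.
rewrite scaler_eq0 (negPf j_neq) orbF.
(* Without double steps, [n + 1] letters cannot reach the last index [n + 2]. *)
have -> : wsum c (fun=> fun=> 0) m n.+1 f 0 = 0.
  by rewrite /wsum big1 // => w _; rewrite path_sum_short ?mulr0 // size_tuple.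
(* With [n + 2] letters only single steps count, so [h] and [h'] contribute the same. *)
have -> : wsum c (fun=> fun=> 0) m n.+2 f 0 = wsum c d m n.+2 f 0.
  by apply: eq_bigr => w _; congr (_ * _); apply: path_sum_max; rewrite size_tuple.
by rewrite subr0 subrr addr0 => /eqP.
Qed.

End Word.

Lemma twist_vanish u v : all [in pred2 k0 k3] u -> all [in pred2 k0 k3] v ->
  (size u + size v = n)%N -> f (u ++ k3 :: v) = side_sign R sd * f (u ++ k0 :: v).
Proof.
move=> u03 v03 uv; have := @twist_eq0 R gam n f k0 (pred2 k0 k3) _ _ detour_sum_eq0 u v u03 v03 uv.
rewrite /twist (bigD1 k0) //= (bigD1 k3) //= big1 ?addr0 => [|a].
  rewrite -[gam k0]/1 -[gam k3]/(- sg) mul1r mulNr => /(_ erefl isT) /eqP.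
  by rewrite subr_eq0 => /eqP ->; rewrite mulrA side_signK mul1r.
by move=> /andP[/negPf a0 /negPf a3]; rewrite /side_gam a0 a3 mul0r.
Qed.

End TwistVanish.

(** * Consequences of orthogonal invariance *)

Lemma expr_sum_tuple (V : pzSemiRingType) (K : finType) n (F : K -> V) :
  \sum_(w : n.-tuple K) \prod_(a <- w) F a = (\sum_a F a) ^+ n.
Proof.
elim: n => [|n IHn].
  rewrite (bigD1 [tuple]) //= big_nil big1 ?addr0 // => w.
  by move/eqP; rewrite [w]tuple0.
rewrite (@sum_tupleS _ _ _ (fun w => \prod_(a <- w) F a)) exprS mulr_suml.
apply: eq_bigr => a _; rewrite -IHn mulr_sumr; apply: eq_bigr => w _.
by rewrite big_cons.
Qed.

Definition side_weight (R : realFieldType) sd (a : 'I_8) : R :=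
  if a == k0 then 1 else if a == k3 then side_sign R sd else 0.

Section Collapse.
Variables (R : realFieldType) (f : series R) (sd : bool) (n : nat).
Hypothesis tw : forall u v, all [in pred2 k0 k3] u -> all [in pred2 k0 k3] v ->
  (size u + size v = n)%N -> f (u ++ k3 :: v) = side_sign R sd * f (u ++ k0 :: v).
Local Notation g := (side_weight R sd).
Local Notation c := (f (nseq n.+1 k0)).

Lemma twist_word u w : all [in pred2 k0 k3] u -> all [in pred2 k0 k3] w ->
  (size u + size w = n.+1)%N ->
  f (u ++ w) = (\prod_(a <- w) g a) * f (u ++ nseq (size w) k0).
Proof.
elim: w u => [|a w IHw] u u03; first by rewrite big_nil mul1r.
case/andP=> a03 w03; rewrite /= addnS => -[sz].
have n03 k : all [in pred2 k0 k3] (nseq k k0) by apply/allP => b /nseqP[->].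
rewrite -cat_rcons IHw ?all_rcons ?a03 ?size_rcons ?addSn ?sz // cat_rcons big_cons.
have -> : f (u ++ a :: nseq (size w) k0) = g a * f (u ++ k0 :: nseq (size w) k0).
  move: a03; rewrite !inE => /orP[] /eqP ->; first by rewrite mul1r.
  by rewrite tw ?size_nseq.
by rewrite mulrCA mulrA [g a * _]mulrC.
Qed.

(** The coefficient of a word is [c] times the product of its weights, as in the expansion of a
    power of a linear form. *)
Lemma hom_series_collapse (A : unitAlgType R) (X Z : A) :
  hom_series f n.+1 (split_pair X Z) = c *: (X + side_sign R sd *: Z) ^+ n.+1.
Proof.
have -> : X + side_sign R sd *: Z = \sum_a g a *: split_pair X Z a.
  rewrite (bigD1 k0) //= (bigD1 k3) //= big1 ?addr0 => [|a].
    by rewrite /split_pair /side_weight /= scale1r.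
  by move=> /andP[/negPf a0 /negPf a3]; rewrite /side_weight a0 a3 scale0r.
rewrite -expr_sum_tuple scaler_sumr; apply: eq_bigr => w _.
have [w03|] := boolP (all [in pred2 k0 k3] w).
  rewrite -[tval w]cat0s (@twist_word [::]) ?size_tuple //= mulrC -scalerA; congr (_ *: _).
  by elim: (tval w) => [|a s IHs]; rewrite ?big_nil ?scale1r //
    !big_cons -scalerAl -IHs -scalerAr scalerA mulrC.
case/allPn => a aw a03; have sp0 : split_pair X Z a = 0.
  by move: a03; rewrite /split_pair !inE negb_or => /andP[/negPf-> /negPf->].
by rewrite (prod_eq0 aw sp0) (prod_eq0 (x := fun a => g a *: _) aw) ?sp0 ?scaler0.
Qed.

End Collapse.

Section DualPath.
Variables (R : realFieldType) (B : algType R) (n : nat).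
Local Notation m := (n.+1.*2.+1).

(* With levels [i./2], [dual_x] raises the level by one while [dual_t] stays inside a level;
   [dual_t] is central because every matrix of the algebra commutes with it. *)
Definition dual_t : 'M[B]_m.+1 := \matrix_(i, l) (if ~~ odd i && (l == i.+1 :> nat) then 1 else 0).
Definition dual_x : 'M[B]_m.+1 := \matrix_(i, l) (if l == i.+2 :> nat then 1 else 0).

Lemma sum_ord_pick (a : nat) (G : nat -> B) :
  \sum_(k < m.+1) (if k == a :> nat then G k else 0) = if (a < m.+1)%N then G a else 0.
Proof.
case: ltnP => [am|ma].
  rewrite (bigD1 (Ordinal am)) //= eqxx big1 ?addr0 // => k.
  by rewrite -val_eqE /= => /negPf ->.
rewrite big1 // => k _; rewrite ltn_eqF //.
exact: leq_trans (ltn_ord k) ma.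
Qed.

Lemma dual_tx : dual_t *m dual_x = dual_x *m dual_t.
Proof.
apply/matrixP=> i l; rewrite !mxE.
transitivity (\sum_(k < m.+1) (if k == i.+1 :> nat then
  (if ~~ odd i && (l == k.+2 :> nat) then 1 else 0) else 0) : B).
  apply: eq_bigr => k _; rewrite !mxE; case: (k =P i.+1 :> nat) => [->|_]; last first.
    by rewrite andbF mul0r.
  by rewrite andbT; case: odd => /=; rewrite ?mul1r ?mul0r.
rewrite (sum_ord_pick _ (fun k => if ~~ odd i && (l == k.+2 :> nat) then 1 else 0)).
transitivity (\sum_(k < m.+1) (if k == i.+2 :> nat then
  (if ~~ odd k && (l == k.+1 :> nat) then 1 else 0) else 0) : B).
  rewrite (sum_ord_pick _ (fun k => if ~~ odd k && (l == k.+1 :> nat) then 1 else 0)) /= negbK.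
  have := ltn_ord l; case: eqP => [->|_] lm; last by rewrite andbF !if_same.
  by rewrite (ltnW (ltnW lm)) (ltnW lm).
by apply: eq_bigr => k _; rewrite !mxE; case: eqP; rewrite ?mul1r ?mul0r.
Qed.

Lemma dual_t_pred : dual_t \in bt_pred half dual_t.
Proof.
apply/bt_predP; split=> // i l; rewrite mxE ltnNge; case: andP => // -[ei /eqP ->].
by rewrite half_leq // leqnSn.
Qed.

Lemma dual_x_pred : dual_x \in bt_pred half dual_t.
Proof.
apply/bt_predP; split; last exact: dual_tx.
move=> i l; rewrite mxE ltnNge; case: eqP => // ->.
by rewrite half_leq // (leq_trans (leqnSn _)).
Qed.

Lemma dual_tC i l b : b * dual_t i l = dual_t i l * b.
Proof. by rewrite mxE; case: ifP; rewrite ?mulr1 ?mul1r ?mulr0 ?mul0r. Qed.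

Local Notation A := (bt half dual_t).
Local Notation dg := (bt_diag half dual_tC).
Definition dualT : A := Bt dual_t_pred.
Definition dualX : A := Bt dual_x_pred.

Lemma dualT_central (a : A) : dualT * a = a * dualT.
Proof. by apply: val_inj; case: a => M /= /bt_predP[]. Qed.

Lemma dualT_sqr : dualT * dualT = 0.
Proof.
apply: btP => i l; rewrite btME bt0E big1 // => k _; rewrite !mxE.
case: andP => [[ei /eqP ->]|_]; last by rewrite mul0r.
by rewrite /= ei mulr0.
Qed.

Lemma dualX_diag b : GRing.comm dualX (dg b).
Proof.
apply: btP => i l; rewrite bt_diagMl bt_diagMr mxE.
by case: eqP; rewrite ?mul1r ?mulr1 ?mulr0 ?mul0r.
Qed.

Lemma dualX_ideal : dualX \in bt_ideal half dual_t.
Proof.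
apply/bt_idealP => i l; rewrite mxE; case: eqP => // ->.
by rewrite ltnn.
Qed.

(** The [2 (n + 2)] indices form [n + 2] levels of two. *)
Lemma dual_nil : nil_ideal (bt_ideal half dual_t) n.+2.
Proof.
by apply: bt_nil => i; rewrite ltn_half_double; apply: ltn_ord.
Qed.

Lemma dualX_exp k (i l : 'I_m.+1) : (dualX ^+ k) i l = if l == (i + k.*2)%N :> nat then 1 else 0.
Proof.
elim: k i => [|k IHk] i.
  by rewrite expr0 bt1E addn0 eq_sym -val_eqE /=; case: eqP.
rewrite exprS btME.
transitivity (\sum_(k' < m.+1) (if k' == i.+2 :> nat then
  (if l == (k' + k.*2)%N :> nat then 1 else 0) else 0) : B).
  by apply: eq_bigr => k' _; rewrite IHk mxE; case: eqP; rewrite ?mul1r ?mul0r.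
rewrite (sum_ord_pick _ (fun k' => if l == (k' + k.*2)%N :> nat then 1 else 0)).
have -> : (i + k.+1.*2 = i.+2 + k.*2)%N by lia.
case: eqP => [e|_]; last by rewrite if_same.
have := ltn_ord l; rewrite e => h; rewrite (leq_ltn_trans _ h) //.
by rewrite leq_addr.
Qed.

(** The power of [dualX] leads from index 0 to the first index of the last level, and [dualT] from
    there to the last index. *)
Lemma dualXT_neq0 : dualX ^+ n.+1 * dualT != 0.
Proof.
apply/eqP => /(congr1 (fun x : A => x ord0 ord_max)); rewrite bt0E btME.
have hm : (n.+1.*2 < m.+1)%N by [].
rewrite (bigD1 (Ordinal hm)) //= big1 ?addr0 => [|k kn].
  by rewrite dualX_exp mxE /= add0n eqxx odd_double /= eqxx mulr1 => /eqP; rewrite oner_eq0.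
by rewrite dualX_exp /= add0n -[k == _ :> nat]/(k == Ordinal hm) (negPf kn) mul0r.
Qed.

End DualPath.

Section OrthVanish.
Variables (R : realFieldType) (f : series R) (sd ps : bool) (n : nat).
Hypotheses (var : variant sd ps f) (orth : orth_invariant ps f).
Hypothesis f03 : vanish03_lt n.+1 f.
Hypothesis tw : forall u v, all [in pred2 k0 k3] u -> all [in pred2 k0 k3] v ->
  (size u + size v = n)%N -> f (u ++ k3 :: v) = side_sign R sd * f (u ++ k0 :: v).
Variables (A : unitAlgType R) (I : pred A).
Hypothesis nilI : nil_ideal I n.+2.
Variables Q1 Q2 x t : A.
Hypothesis Q12 : clifford Q1 Q2.
Hypotheses (xI : x \in I) (x1 : GRing.comm x Q1) (x2 : GRing.comm x Q2).
Hypotheses (tC : forall a, t * a = a * t) (tt : t * t = 0).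
Hypothesis xt : x ^+ n.+1 * t != 0.

Local Notation P := (cliffP Q1 Q2).
Local Notation sg := (side_sign R sd).
Local Notation c := (f (nseq n.+1 k0)).

Lemma reduced_collapse X Z :
    qpar false Q1 X -> qpar false Q2 X -> qpar true Q1 Z -> qpar true Q2 Z ->
  reduced f n.+2 Q1 Q2 (X + Z) = (f [::])%:A + c *: (X + sg *: Z) ^+ n.+1.
Proof.
move=> X1 X2 Z1 Z2; rewrite /reduced (eq_eval_series _ _ (splitv_pair Q12 X1 X2 Z1 Z2)).
rewrite /eval_series big_ord_recr /= -/(hom_series _ _ _) (hom_series_collapse tw).
congr (_ + _); rewrite big_ord_recl -/(hom_series _ _ _) hom_series0 big1 ?addr0 // => k _.
apply: hom_series_eq0 => [a|w sw]; last by apply: f03; rewrite sw /= ltnS.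
by rewrite /split_pair !inE negb_or => /andP[/negPf-> /negPf->].
Qed.

Lemma orth_vanish : c = 0.
Proof.
have [u uU [ux uP]] := reduced_orth var nilI Q12 orth xI x1 x2 tC tt.
have xP : GRing.comm x P by rewrite cliffPE; apply: commrN; apply: commrM.
have x22 : GRing.comm x (2 + x) by apply: commrD => //; apply: commr_nat.
set Z := t * x * (2 + x) * P.
have parP e Q : GRing.comm x Q -> qpar e Q P -> qpar e Q Z.
  move=> xQ PQ; have cQ : GRing.comm Q (t * x * (2 + x)).
    apply: commrM; first by apply: commrM; [rewrite /GRing.comm tC|apply/commr_sym].
    by apply: commrD; [apply: commr_nat|apply/commr_sym].
  rewrite /qpar /Z -mulrA PQ; case: (e) => //; rewrite ?mulrN ?mulrA; rewrite -cQ ?mulrA //.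
have Z1 : qpar true Q1 Z.
  by apply: parP => //; rewrite /qpar (clifford_PQ1 Q12) (clifford_Q1P Q12).
have Z2 : qpar true Q2 Z.
  by apply: parP => //; rewrite /qpar (clifford_PQ2 Q12) (clifford_Q2P Q12) opprK.
rewrite -[x in reduced _ _ _ _ x = _]addr0 !reduced_collapse //; try exact: qpar0.
(* [u] commutes with [x], [t] and [P], hence with the value, and the conjugation disappears. *)
rewrite scaler0 addr0 conj_comm //; last first.
  have cZ : GRing.comm u Z.
    apply: commrM => //; apply: commrM; first by apply: commrM; [rewrite /GRing.comm tC|].
    by apply: commrD; [apply: commr_nat|].
  apply: commrD; first by rewrite /GRing.comm mulr_algl mulr_algr.
  rewrite /GRing.comm -scalerAl -scalerAr; congr (_ *: _); apply: commrX; apply: commrD => //.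
  by rewrite /GRing.comm -scalerAl -scalerAr cZ.
(* [x + sg *: Z] is [x * (1 + y)] with [y * y = 0], so its powers are linear in [y]. *)
pose y := sg *: (t * (2 + x) * P).
have yy : y * y = 0.
  rewrite /y -scalerAl -scalerAr -[t * _ * P]mulrA -[t * _ * _]mulrA [_ * (t * _)]mulrA -tC.
  by rewrite !mulrA tt !mul0r !scaler0.
have xy : GRing.comm x y.
  rewrite /GRing.comm /y -scalerAl -scalerAr; congr (_ *: _).
  by apply: commrM => //; apply: commrM => //; rewrite /GRing.comm tC.
have -> : x + sg *: Z = x * (1 + y).
  by rewrite mulrDr mulr1 /y -scalerAr /Z !mulrA -(tC x).
have y1k k : (1 + y) ^+ k = 1 + y *+ k.
  elim: k => [|k IHk]; first by rewrite expr0 mulr0n addr0.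
  by rewrite exprS IHk mulrDl mul1r mulrDr mulr1 mulrnAr yy mul0rn addr0 -addrA -mulrSr.
have x1y : GRing.comm x (1 + y) by apply: commrD => //; apply: commr1.
move/addrI; rewrite exprMn_comm // y1k mulrDr mulr1 scalerDr -[LHS]addr0 => /addrI /esym.
(* As [x ^+ n.+2 = 0], the factor [2 + x] inside [y] acts as 2. *)
have xn : x ^+ n.+2 = 0 by apply: (nilX nilI).
have -> : x ^+ n.+1 * (y *+ n.+1) = (sg * (2 * n.+1%:R)) *: (x ^+ n.+1 * t * P).
  have -> : x ^+ n.+1 * (y *+ n.+1) = n.+1%:R *: (x ^+ n.+1 * y) by rewrite mulrnAr scaler_nat.
  have -> : x ^+ n.+1 * y = (sg * 2) *: (x ^+ n.+1 * t * P).
    rewrite /y -scalerAr -scalerA; congr (_ *: _).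
    rewrite scaler_nat -mulrnAl !mulrA; congr (_ * _).
    rewrite mulrDr -[_ * t * x]mulrA tC mulrA -exprSr xn mul0r addr0.
    by rewrite mulr_natr.
  by rewrite scalerA; congr (_ *: _); ring.
move/eqP; rewrite scalerA scaler_eq0 => /orP[|/eqP xtP].
  rewrite !mulf_eq0 !pnatr_eq0 !orbF => /orP[/eqP //|/eqP sg0].
  by have := side_signK R sd; rewrite sg0 mul0r => /eqP; rewrite eq_sym oner_eq0.
case/eqP: xt; apply: (mulIr (sqrN1_unit (clifford_Psqr Q12))).
by rewrite xtP mul0r.
Qed.

End OrthVanish.

Section Vanish.
Variables (R : realFieldType) (B : algType R) (q1 q2 j : B).
Hypotheses (q11 : q1 * q1 = -1) (q22 : q2 * q2 = -1) (q12 : q1 * q2 = - (q2 * q1)).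
Hypotheses (jj : j * j = 1) (j1 : j * q1 = - (q1 * j)) (j2 : j * q2 = - (q2 * j)).
Hypothesis j_neq : 1 + j != 0.
Variables (f : series R) (sd ps : bool).
Hypotheses (var : variant sd ps f) (orth : orth_invariant ps f).

(** Path matrices give the relations between coefficients; dual path matrices then supply a central
    [t] with [x ^+ n.+1 * t] non-zero. *)
Lemma vanish_nseq n : vanish03_lt n.+1 f -> f (nseq n.+1 k0) = 0.
Proof.
move=> f03.
have tw := twist_vanish q11 q22 q12 jj j1 j2 j_neq var f03.
have Q12 := bt_diag_clifford half (@dual_tC R B n) q11 q22 q12.
exact: (orth_vanish var orth f03 tw (dual_nil B n) Q12 (dualX_ideal B n)
  (dualX_diag n q1) (dualX_diag n q2) (@dualT_central R B n) (dualT_sqr B n) (dualXT_neq0 B n)).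
Qed.

(** Induction on the length: [twist_word] reduces each word to a power of [k0]. *)
Lemma variant_vanish03 : vanish03 f.
Proof.
have H n : vanish03_lt n f.
  elim: n => [|n IHn] w; first by rewrite ltn0 andbF.
  case/andP=> w0; rewrite ltnS leq_eqVlt => /orP[/eqP sw|sw] w03; last by apply: IHn; rewrite // w0.
  case: n IHn sw => [|n] IHn sw; first by rewrite sw in w0.
  have tw := twist_vanish q11 q22 q12 jj j1 j2 j_neq var IHn.
  by rewrite -[w]cat0s (twist_word tw) // sw vanish_nseq // mulr0.
by move=> w w0; apply: (H (size w).+1); rewrite ltnS leqnn andbT lt0n size_eq0.
Qed.

End Vanish.

(** * A quaternionic matrix model *)

Section QuaternionMatrices.
Variable R : realFieldType.

Definition imx : 'M[R]_2 := \matrix_(i, l) (if (i < l)%N then 1 else if (l < i)%N then -1 else 0).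

Lemma imx_sqr : imx *m imx = - 1%:M.
Proof.
apply/matrixP=> i l; rewrite !mxE !big_ord_recl big_ord0 !mxE.
case: i l => [[|[|i]] hi] [[|[|l]] hl] //=; lra.
Qed.

(** The quaternions are too small: there, what anticommutes with [q1] and [q2] is a real multiple of
    [q1 * q2] and cannot square to 1. In blocks, off-diagonal matrices anticommute with [mj]. *)
Definition mq1 : 'M[R]_4 := block_mx (0 : 'M_2) imx imx (0 : 'M_2).
Definition mq2 : 'M[R]_4 := block_mx (0 : 'M_2) 1%:M (- 1%:M) (0 : 'M_2).
Definition mj : 'M[R]_4 := block_mx (1%:M : 'M_2) 0 0 (- 1%:M : 'M_2).

Lemma one_block : (1 : 'M[R]_4) = block_mx (1%:M : 'M_2) 0 0 (1%:M : 'M_2).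
Proof. by rewrite -scalar_mx_block. Qed.

Let blockE := (@mulmxN, @mulNmx, @mulmx0, @mul0mx, @mulmx1, @mul1mx, imx_sqr,
  @addr0, @add0r, @oppr0, @opprK).

Let mulE (a b c d a' b' c' d' : 'M[R]_2) :
  (block_mx a b c d : 'M[R]_4) * (block_mx a' b' c' d' : 'M[R]_4) =
  block_mx (a *m a' + b *m c') (a *m b' + b *m d') (c *m a' + d *m c') (c *m b' + d *m d').
Proof. exact: (@mulmx_block R 2 2 2 2 2 2 a b c d a' b' c' d'). Qed.
Let oppE (a b c d : 'M[R]_2) :
  - (block_mx a b c d : 'M[R]_4) = block_mx (- a) (- b) (- c) (- d).
Proof. exact: (@opp_block_mx R 2 2 2 2 a b c d). Qed.

Lemma mq11 : mq1 * mq1 = -1.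
Proof. by rewrite one_block mulE oppE !blockE. Qed.
Lemma mq22 : mq2 * mq2 = -1.
Proof. by rewrite one_block mulE oppE !blockE. Qed.
Lemma mq12 : mq1 * mq2 = - (mq2 * mq1).
Proof. by rewrite !mulE oppE !blockE. Qed.
Lemma mjj : mj * mj = 1.
Proof. by rewrite one_block mulE !blockE. Qed.
Lemma mj1 : mj * mq1 = - (mq1 * mj).
Proof. by rewrite !mulE oppE !blockE. Qed.
Lemma mj2 : mj * mq2 = - (mq2 * mj).
Proof. by rewrite !mulE oppE !blockE. Qed.
Lemma mj_neq : 1 + mj != 0.
Proof.
rewrite addr_eq0 one_block oppE; apply/eqP => e.
have [/matrixP/(_ 0 0) + _ _ _] := @eq_block_mx R 2 2 2 2 _ _ _ _ _ _ _ _ e.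
by rewrite !mxE {e} /= => h; lra.
Qed.

End QuaternionMatrices.

(** * Recovering a series from its values *)

Section ReadOff.
Variables (R : realFieldType) (B : algType R) (q1 q2 : B).
Hypotheses (q11 : q1 * q1 = -1) (q22 : q2 * q2 = -1) (q12 : q1 * q2 = - (q2 * q1)).

Lemma path_sum_word (w w' : seq 'I_8) i : (i <= size w)%N ->
  path_sum (fun a i => (onth w i == Some a)%:R : R) (fun _ _ => 0) (size w) w' i
  = (w' == drop i w)%:R.
Proof.
elim: w' i => [|a w' IHw] i iw /=.
  by rewrite [[::] == _]eq_sym -size_eq0 size_drop subn_eq0 eqn_leq iw.
rewrite mul0r addr0; have [ltiw|] := ltnP i (size w).
  have -> : onth w i = Some (nth a w i) by rewrite onthE (nth_map a).
  rewrite IHw // (drop_nth a ltiw) eqseq_cons [a == _]eq_sym.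
  by rewrite -[Some _ == _]/(nth a w i == a); case: eqP; rewrite ?mul1r ?mul0r.
by move=> wi; rewrite onth_default // drop_oversize // mul0r.
Qed.

(** Elements of the Clifford algebra with the parities prescribed for the split variables. *)
Definition split_coef (a : 'I_8) : B :=
  match odd a./2, odd a with
  | false, false => 1 | false, true => q1 | true, false => q2 | true, true => q1 * q2
  end.

Let q121 : q1 * q2 * (q1 * q2) = -1.
Proof. by rewrite {1}q12 mulNr mulrA -(mulrA q2) q11 mulrN1 mulNr opprK q22. Qed.

(** Each of these elements squares to 1 or -1. *)
Lemma split_coef_mul_eq0 a x : split_coef a * x = 0 -> x = 0.
Proof.
have sq q : q * q = -1 -> q * x = 0 -> x = 0.
  move=> qq qx; have := mulrA q q x; rewrite qx qq mulr0 mulN1r => /esym/eqP.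
  by rewrite oppr_eq0 => /eqP.
by rewrite /split_coef; case: odd; case: odd; [apply: sq..|rewrite mul1r].
Qed.

Lemma split_coef_prod (w : seq 'I_8) : \prod_(a <- w) split_coef a != 0.
Proof.
elim: w => [|a w IHw]; first by rewrite big_nil oner_eq0.
by rewrite big_cons; apply/eqP => /split_coef_mul_eq0 /eqP; rewrite (negPf IHw).
Qed.

(** Split variables placed along a path spelling [w] isolate [f w], up to a non-zero product of
    [split_coef], in the corner entry, where 1 has entry 0. *)
Lemma eval_series_const (f : series R) (w : seq 'I_8) :
  (forall (A : unitAlgType R) (I : pred A) (N : nat), nil_ideal I N ->
   forall Q1 Q2 : A, clifford Q1 Q2 -> forall R1 R2, R1 \in I -> R2 \in I ->
   eval_series f N (splitv Q1 Q2 R1 R2) = 1) ->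
  w != [::] -> f w = 0.
Proof.
move=> H w0; pose m := size w.
pose A := bt id (0 : 'M[B]_m.+1); pose dg := bt_diag id (@pathT R B m).
pose r (a : 'I_8) : A := step_mx m (fun i => (onth w i == Some a)%:R *: split_coef a).
have Q12 : clifford (dg q1) (dg q2) := bt_diag_clifford _ _ q11 q22 q12.
have rI (p : pred 'I_8) (x : A) : (\sum_(a | p a) r a) * x \in bt_ideal id (0 : 'M[B]_m.+1).
  apply: (nilMr (path_nil B m)); elim/big_ind: _; first exact: (nil0 (path_nil B m)).
    by move=> y z; apply: (nilD (path_nil B m)).
  by move=> a _; apply: step_mx_ideal.
have rpar e q a : split_coef a * q = (if e then - (q * split_coef a) else q * split_coef a) ->
    qpar e (dg q) (r a).
  move=> aq; apply: btP => i l; rewrite bt_diagMr.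
  have -> : (if e then - (dg q * r a) else dg q * r a) i l =
            if e then - (q * r a i l) else q * r a i l.
    by case: e {aq}; rewrite ?btNE bt_diagMl.
  rewrite step_mxE; case: eqP => _; last by rewrite mul0r mulr0 oppr0 if_same.
  by rewrite -scalerAl aq -scalerAr; case: e {aq}; rewrite ?scalerN.
have r1 (a : 'I_8) : qpar (odd a./2) (dg q1) (r a).
  apply: rpar; rewrite /split_coef; case: odd; case: odd; rewrite ?mul1r ?mulr1 //.
    by rewrite [q1 * (q1 * q2)]mulrA q11 mulN1r opprK q12 mulNr -mulrA q11 mulrN1 opprK.
  by rewrite q12 opprK.
have r2 (a : 'I_8) : qpar (odd a) (dg q2) (r a).
  apply: rpar; rewrite /split_coef; case: odd; case: odd; rewrite ?mul1r ?mulr1 //.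
  by rewrite [q2 * (q1 * q2)]mulrA -[q2 * q1]opprK -q12 mulNr opprK.
have := H A _ _ (path_nil B m) _ _ Q12 _ _
  (rI (fun a => (a < 4)%N) (dg q1)) (rI (fun a => ~~ (a < 4)%N) (dg q2)).
rewrite (eq_eval_series _ _ (splitv_sum Q12 r1 r2)).
move=> /(congr1 (fun x : A => x ord0 ord_max)); rewrite bt1E.
have -> : (ord0 == ord_max :> 'I_m.+1) = false.
  by rewrite -val_eqE /= eq_sym; apply/negbTE; rewrite /m size_eq0.
have rE a (i l : 'I_m.+1) : r a i l =
    ((l == i.+1 :> nat)%:R * (onth w i == Some a)%:R + (l == i.+2 :> nat)%:R * 0) *: split_coef a.
  by rewrite step_mxE mulr0 addr0; case: eqP; rewrite ?mul1r ?mul0r ?scale0r.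
have rp (w' : seq 'I_8) : (\prod_(a <- w') r a : A) ord0 ord_max =
    (w' == w)%:R *: \prod_(a <- w') split_coef a.
  have := @prod_path R B m id _ r split_coef (fun a i => (onth w i == Some a)%:R)
    (fun _ _ => 0) rE w' ord0 ord_max.
  by rewrite /= (path_sum_word _ (leq0n _)) drop0.
(* The truncation at [size w + 1] makes [size w] the top degree; shorter words do not reach the
   corner. *)
rewrite /eval_series bt_sumE big_ord_recr /= big1 ?add0r => [|k _]; last first.
  rewrite bt_sumE big1 // => w' _; rewrite btZE rp.
  rewrite (_ : (tval w' == w) = false) ?scale0r ?scaler0 //.
  by apply/eqP => ww; have := ltn_ord k; rewrite -(size_tuple w') ww ltnn.
rewrite bt_sumE (bigD1 (in_tuple w)) //= [X in _ + X]big1 ?addr0 => [|w' ww'].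
  rewrite btZE rp eqxx scale1r => /eqP.
  by rewrite scaler_eq0 (negPf (split_coef_prod w)) orbF => /eqP.
by rewrite btZE rp -[tval w' == w]/(w' == in_tuple w) (negPf ww') scale0r scaler0.
Qed.

End ReadOff.

(** * The scalar and pseudoscalar cases *)

Theorem mainTheorem5 (R : realFieldType) :
  (* (a) scalar case *)
  (forall f : series R,
     (left_variant false f \/ right_variant false f) ->
     orth_invariant false f -> f [::] = 1 ->
     f = const_series 1) /\
  (* (c) left-variant pseudoscalar case *)
  (forall f : series R,
     left_variant true f -> orth_invariant true f -> f [::] = 1 ->
     is_AL f) /\
  (* (c') right-variant pseudoscalar case *)
  (forall f : series R,
     right_variant true f -> orth_invariant true f -> f [::] = 1 ->
     is_AR f).
Proof.
(* One formula for all cases: the quaternionic model gives the vanishing on words in [k0] and [k3],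
   and the normal form then gives the value. *)
have main sd ps (f : series R) : variant sd ps f -> orth_invariant ps f -> f [::] = 1 ->
    forall (A : unitAlgType R) (I : pred A) (N : nat), nil_ideal I N ->
    forall Q1 Q2 : A, clifford Q1 Q2 -> forall R1 R2 : A, R1 \in I -> R2 \in I ->
    fq_eval ps f N Q1 Q2 (Q1 + R1) (Q2 + R2) =
    if ps then - pol N (if sd then (Q1 + R1)^-1 * (Q2 + R2) else (Q1 + R1) * (Q2 + R2)^-1) else 1.
  move=> var orth f1 A I N nilI Q1 Q2 Q12 R1 R2 R1I R2I.
  have f03 := variant_vanish03 (mq11 R) (mq22 R) (mq12 R) (mjj R) (mj1 R) (mj2 R)
    (mj_neq R) var orth.
  by apply: (fq_eval_variant f03 f1 nilI Q12 var); apply: ceq_add.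
split; [|split].
- move=> f var orth f1; apply: boolp.funext => -[|a w] //=.
  have [sd vsd] : exists sd, variant sd false f.
    by case: var => [/left_variantE|/right_variantE]; [exists false|exists true].
  apply: (eval_series_const (mq11 R) (mq22 R) (mq12 R)) => // A I N nilI Q1 Q2 Q12 R1 R2 R1I R2I.
  have := main _ _ _ vsd orth f1 A I N nilI Q1 Q2 Q12 R1 R2 R1I R2I.
  by rewrite /fq_eval mulr1 ![_ + _ - _]addrC !addKr.
- move=> f /left_variantE var orth f1 A I N nilI Q1 Q2 Q12 R1 R2 R1I R2I.
  exact: (main _ _ _ var orth f1 A I N nilI Q1 Q2 Q12 R1 R2 R1I R2I).
- move=> f /right_variantE var orth f1 A I N nilI Q1 Q2 Q12 R1 R2 R1I R2I.
  exact: (main _ _ _ var orth f1 A I N nilI Q1 Q2 Q12 R1 R2 R1I R2I).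
Qed.
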